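(* Let $\Theta=(\Theta_1,\dots,\Theta_N)$ be an $N$-tuple of pairwise commuting symmetric positive definite $n\times n$ matrices. An $\mathbb{R}^n$-valued field $X=(X_t)_{t\in\mathbb{Z}^N}$ is stationary if and only if (i) for every $j\in\{1,\dots,N\}$ and all $t_1,\dots,t_{j-1},t_{j+1},\dots,t_N\in\mathbb{Z}$, $e^{m\Theta_j}X_{t_1,\dots,t_{j-1},m,t_{j+1},\dots,t_N}\to0$ in probability as $m\to-\infty$; and (ii) $X_t=\sum_{i\in\{0,1\}^N,\,i\ne\mathbf 0}(-1)^{1+i_1+\dots+i_N}e^{-i\ast\Theta}X_{t_1-i_1,\dots,t_N-i_N}+\Delta_tG$ for all $t\in\mathbb{Z}^N$, for some $G\in\mathcal{G}_{\Theta,0}$. Moreover, in this case $G$ is unique and the fields are related by $X=(\mathcal{L}^{-1}_\Theta\circ\mathcal{M}^{-1}_\Theta)(G)$ and $G=(\mathcal{M}_\Theta\circ\mathcal{L}_\Theta)(X)$.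
   Context: $t\ast\Theta=\sum_{j=1}^N t_j\Theta_j$. Equality in law of fields means equality of all finite-dimensional distributions. $X$ is stationary if $(X_{t+s})_t$ and $(X_t)_t$ are equal in law for every $s\in\mathbb{Z}^N$. For a field $Z=(Z_t)_{t\in\mathbb{Z}^N}$, $\Delta_t Z=\sum_{i\in\{0,1\}^N}(-1)^{i_1+\dots+i_N}Z_{t_1-i_1,\dots,t_N-i_N}$; for a field $Y=(Y_{e^t})_{t\in\mathbb{Z}^N}$, $\Delta_tY=\sum_{i\in\{0,1\}^N}(-1)^{i_1+\dots+i_N}Y_{e^{t-i}}$. $G$ is a stationary increment field if $(\Delta_{t+s}G)_{t}$ and $(\Delta_tG)_{t}$ are equal in law for every $s$. $\mathcal{G}_\Theta$ is the class of stationary increment fields $G$ such that $\sum_{j=-\infty}^te^{j\ast\Theta}\Delta_jG:=\lim_{M_1\to\infty}\cdots\lim_{M_N\to\infty}\sum_{j_1=-M_1}^{t_1}\cdots\sum_{j_N=-M_N}^{t_N}e^{j\ast\Theta}\Delta_jG$ converges in probability for every $t$; $\mathcal{G}_{\Theta,0}$ is the subclass with $G_t=0$ a.s. whenever $t_l=0$ for some $l$. Transformations: $(\mathcal{L}_\Theta X)_{e^t}=e^{t\ast\Theta}X_t$, $(\mathcal{L}^{-1}_\Theta Y)_t=e^{-t\ast\Theta}Y_{e^t}$, $(\mathcal{M}^{-1}_\Theta G)_{e^t}=\sum_{j=-\infty}^te^{j\ast\Theta}\Delta_jG$, and $(\mathcal{M}_\Theta Y)_t=(-1)^{|\{l:t_l<0\}|}\sum_j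 e^{-j\ast\Theta}\Delta_jY$, where the sum runs over $j\in\mathbb{Z}^N$ with $1\le j_l\le t_l$ if $t_l\ge0$ and $t_l+1\le j_l\le0$ if $t_l<0$. *)

(* Defs.v *)
From HB Require Import structures.
From mathcomp Require Import all_boot all_order all_algebra.
From mathcomp Require Import all_classical all_reals all_analysis.
Set Implicit Arguments. Unset Strict Implicit. Unset Printing Implicit Defensive.
Import Order.TTheory GRing.Theory Num.Theory.
Import numFieldNormedType.Exports.
Local Open Scope classical_set_scope.
Local Open Scope ring_scope.

Definition idx (N : nat) := 'I_N -> int.

Section Defs.
Context {R : realType} {d : measure_display} {T : measurableType d}.
Variable P : probability T R.
Variables (N n : nat).

Definition rvec (Z : T -> 'cV[R]_n) : Prop :=
  forall i : 'I_n, measurable_fun setT (fun w => Z w i 0).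

Definition rfield (X : idx N -> T -> 'cV[R]_n) : Prop := forall t, rvec (X t).

Definition as_eq (Z Z' : T -> 'cV[R]_n) : Prop :=
  P [set w | Z w <> Z' w] = 0%E.

(* Equality in law of two fields (on the same probability space):
   equality of all finite-dimensional distributions, tested on measurable
   rectangles (a generating pi-system of the Borel sets of R^(k*n)). *)
Definition eq_law (X Y : idx N -> T -> 'cV[R]_n) : Prop :=
  forall (k : nat) (ts : 'I_k -> idx N) (B : 'I_k -> 'I_n -> set R),
    (forall a b, measurable (B a b)) ->
    P [set w | forall a b, X (ts a) w b 0 \in B a b] =
    P [set w | forall a b, Y (ts a) w b 0 \in B a b].

Definition idx_shift (t s : idx N) : idx N := fun l => t l + s l.

Definition stationary (X : idx N -> T -> 'cV[R]_n) : Prop :=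
  forall s, eq_law (fun t => X (idx_shift t s)) X.

Definition subi (t : idx N) (i : {ffun 'I_N -> bool}) : idx N :=
  fun l => t l - (i l : nat)%:Z.

Definition Delta (Z : idx N -> T -> 'cV[R]_n) (t : idx N) : T -> 'cV[R]_n :=
  fun w => \sum_(i : {ffun 'I_N -> bool}) (-1) ^+ (\sum_l (i l : nat)) *: Z (subi t i) w.

Definition stat_incr (G : idx N -> T -> 'cV[R]_n) : Prop :=
  forall s, eq_law (fun t => Delta G (idx_shift t s)) (fun t => Delta G t).

Definition cvg_prob (Z : nat -> T -> 'cV[R]_n) (L : T -> 'cV[R]_n) : Prop :=
  forall eps : R, 0 < eps ->
    (fun m => P [set w | eps < `|Z m w - L w|]) @ \oo --> 0%E.

(* iterated limit in probability lim_{M_1} ... lim_{M_N} F M = L :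
   Ls k M is the limit after taking the innermost limits over M_k,...,M_{N-1}
   (0-based indices); it depends only on M_0, ..., M_{k-1}. *)
Definition upd (M : 'I_N -> nat) (k : 'I_N) (m : nat) : 'I_N -> nat :=
  fun l => if l == k then m else M l.

Definition iter_cvg_prob (F : ('I_N -> nat) -> T -> 'cV[R]_n) (L : T -> 'cV[R]_n) : Prop :=
  exists Ls : nat -> ('I_N -> nat) -> T -> 'cV[R]_n,
    [/\ Ls N = F,
        (forall k M, rvec (Ls k M)),
        (forall k M M', (forall l : 'I_N, (l < k)%N -> M l = M' l) -> Ls k M = Ls k M'),
        (forall (k : 'I_N) M, cvg_prob (fun m => Ls k.+1 (upd M k m)) (Ls k M)) &
        (forall M, Ls 0%N M = L)].

End Defs.

Definition expmx {R : realType} {n : nat} (A : 'M[R]_n) : 'M[R]_n :=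
  lim ((fun K => \sum_(k < K) (k`!%:R)^-1 *: A ^+ k) @ \oo).

Definition tTheta {R : realType} {N n : nat} (t : idx N) (Th : 'I_N -> 'M[R]_n) : 'M[R]_n :=
  \sum_(j < N) (t j)%:~R *: Th j.

(* finite box sum: sum of F j over j in Z^N with a_l <= j_l <= b_l for all l *)
Definition boxsum {V : zmodType} {N : nat} (a b : idx N) (F : idx N -> V) : V :=
  let B := (\max_(l < N) `|b l - a l|%N)%N in
  \sum_(k : {ffun 'I_N -> 'I_B.+1} | [forall l, a l + (k l : nat)%:Z <= b l])
     F (fun l => a l + (k l : nat)%:Z).

Section Fields.
Context {R : realType} {d : measure_display} {T : measurableType d}.
Variable P : probability T R.
Variables (N n : nat).
Variable Th : 'I_N -> 'M[R]_n.

Definition Minv_psum (G : idx N -> T -> 'cV[R]_n) (t : idx N) (M : 'I_N -> nat) : T -> 'cV[R]_n :=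
  fun w => boxsum (fun l => - (M l)%:Z) t (fun j => expmx (tTheta j Th) *m Delta G j w).

Definition in_GTheta (G : idx N -> T -> 'cV[R]_n) : Prop :=
  [/\ rfield G, stat_incr P G &
      forall t, exists L, iter_cvg_prob P (Minv_psum G t) L].

Definition in_GTheta0 (G : idx N -> T -> 'cV[R]_n) : Prop :=
  in_GTheta G /\
  forall t : idx N, (exists l, t l = 0) -> as_eq P (G t) (fun _ => 0).

(* (L_Theta X)_{e^t} = e^{t*Theta} X_t *)
Definition Ltheta (X : idx N -> T -> 'cV[R]_n) : idx N -> T -> 'cV[R]_n :=
  fun t w => expmx (tTheta t Th) *m X t w.

Definition Mtheta (Y : idx N -> T -> 'cV[R]_n) : idx N -> T -> 'cV[R]_n :=
  fun t w => (-1) ^+ #|[set l : 'I_N | t l < 0]| *: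
    boxsum (fun l => if 0 <= t l then 1 else t l + 1)
           (fun l => if 0 <= t l then t l else 0)
           (fun j => expmx (- tTheta j Th) *m Delta Y j w).

Definition idx_of_bits (i : {ffun 'I_N -> bool}) : idx N := fun l => (i l : nat)%:Z.

Definition recursion (X G : idx N -> T -> 'cV[R]_n) : Prop :=
  forall t : idx N, as_eq P (X t) (fun w =>
    \sum_(i : {ffun 'I_N -> bool} | i != [ffun => false])
       (-1) ^+ (1 + \sum_l (i l : nat)) *:
          (expmx (- tTheta (idx_of_bits i) Th) *m X (subi t i) w)
    + Delta G t w).

Definition updz (t : idx N) (j : 'I_N) (m : int) : idx N :=
  fun l => if l == j then m else t l.

Definition cond_i (X : idx N -> T -> 'cV[R]_n) : Prop :=
  forall (j : 'I_N) (t : idx N),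
    cvg_prob P (fun k : nat => fun w =>
       expmx ((- (k%:Z))%:~R *: Th j) *m X (updz t j (- (k%:Z))) w) (fun _ => 0).

End Fields.

(* Main.v *)
(* Put [Y_t = e^(t*Theta) X_t].  The recursion says exactly that
   [Delta_t Y = e^(t*Theta) Delta_t G] almost surely, so summing [Delta Y] over
   the box [(t - r, t]] expresses the alternating sum of [Y] over the corners of
   the box through the increments of [G].
   If (i) holds, the corners lying on lower faces vanish in probability when the
   box grows in one direction after the other, so that the iterated limit is
   [Y_t].  For fixed [r], the corner sum rescaled by [e^(-t*Theta)] is a
   shift-invariant linear filter of the stationary field [Delta G], hence
   stationary; letting the [r_l] go to infinity one by one, [X] is stationary.
   Conversely a stationary [X] satisfies (i) because its marginals are tight and
   [e^(-k Theta_j)] decays geometrically, and [G] is obtained from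
   [e^(-t*Theta) Delta_t Y] by summation from the coordinate hyperplanes, which
   inverts [Delta] on the fields that vanish there. *)

Require Import Defs.
From HB Require Import structures.
From mathcomp Require Import all_boot all_order all_algebra.
From mathcomp Require Import all_classical all_reals all_analysis.
From mathcomp Require Import measurable_realfun zify ring lra.
Set Implicit Arguments. Unset Strict Implicit. Unset Printing Implicit Defensive.
Import Order.TTheory GRing.Theory Num.Theory.
Import numFieldNormedType.Exports.
Local Open Scope classical_set_scope.
Local Open Scope ring_scope.

(** * Matrix exponential *)

(** Positive definiteness enters through one contraction estimate, obtained without diagonalization:
    a bound [q > 1] for the quadratic form of [e^A] turns, by completing a square, into
    [|e^(-A) w|^2 <= q^(-2) |w|^2]. The relations between [X] and [G] hold only almost surely at
    each index, whereas telescoping and summation act on a whole path. Since Z^N is countable, one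
    null set serves all indices, and the algebra is then done path by path on deterministic
    functions. Equality in law must survive limits in probability. It is therefore tested on closed
    orthants: these form a pi-system, and a slightly widened orthant absorbs the approximation
    error. The iterated limit requires explicit intermediate limits. They are the corner sums in
    which only the first [k] coordinates move; the same sums carry the induction that proves
    stationarity. *)

Lemma mx_norm_leP (R : realType) (m n : nat) (x : 'M[R]_(m, n)) (e : R) :
  0 <= e -> (`|x| <= e) <-> (forall i j, `|x i j| <= e).
Proof.
move=> e0; rewrite [leLHS]/Num.Def.normr /= mx_normrE; split.
  by move=> /bigmax_leP[_ h] i j; exact: (h (i, j)).
by move=> h; apply/bigmax_leP; split=> // -[i j] _; exact: h.
Qed.

Lemma mx_entry_le_norm (R : realType) (m n : nat) (x : 'M[R]_(m, n)) i j :
  `|x i j| <= `|x|.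
Proof. exact: (iffLR (mx_norm_leP x (normr_ge0 x)) (lexx _)). Qed.

Lemma cvg_mx_entries (R : realType) (m n : nat) (F : nat -> 'M[R]_(m, n))
    (L : 'M[R]_(m, n)) :
  (forall i j, (fun k => F k i j) @ \oo --> L i j) -> F @ \oo --> L.
Proof.
move=> h; apply/cvgrPdist_le => e e0.
have : \forall k \near \oo, forall i j, `|L i j - F k i j| <= e.
  apply: filter_forall => i; apply: filter_forall => j.
  by have /cvgrPdist_le/(_ e e0) := h i j.
apply: filterS => k hk; apply/mx_norm_leP; first exact: ltW.
by move=> i j; rewrite !mxE.
Qed.

Definition expmx_psum {R : realType} {n : nat} (A : 'M[R]_n) (K : nat) : 'M[R]_n :=
  \sum_(k < K) (k`!%:R)^-1 *: A ^+ k.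

(** A crude substitute for an operator norm: multiplication by [A] enlarges a uniform bound on
    entries by at most this factor, so that series of matrices are dominated by scalar exponential
    series. *)
Definition abs_sum {R : realType} {n : nat} (A : 'M[R]_n) : R :=
  \sum_i \sum_j `|A i j|.

Section MatrixExponential.
Context {R : realType} {n : nat}.
Implicit Types A B M : 'M[R]_n.

Lemma abs_sum_ge0 A : 0 <= abs_sum A.
Proof. by apply: sumr_ge0 => i _; apply: sumr_ge0. Qed.

Lemma entry_mul_le m A (M : 'M[R]_(n, m)) c :
  (forall i j, `|M i j| <= c) -> forall i j, `|(A *m M) i j| <= abs_sum A * c.
Proof.
move=> hM i j; rewrite mxE (le_trans (ler_norm_sum _ _ _))//.
have c0 : 0 <= c by apply: le_trans (hM i j).
apply: (@le_trans _ _ ((\sum_k `|A i k|) * c)).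
  by rewrite mulr_suml; apply: ler_sum => k _; rewrite normrM ler_wpM2l.
rewrite ler_wpM2r // /abs_sum [leRHS](bigD1 i)//= lerDl.
by apply: sumr_ge0 => k _; apply: sumr_ge0.
Qed.

Lemma entry_exp_mul_le A M c k : (forall i j, `|M i j| <= c) ->
  forall i j, `|(A ^+ k * M) i j| <= abs_sum A ^+ k * c.
Proof.
move=> hM; elim: k => [|k IH] i j; first by rewrite !expr0 !mul1r.
by rewrite !exprS -!mulrA -mulmxE; apply: entry_mul_le.
Qed.

Lemma entry1_le (i j : 'I_n) : `|(1 : 'M[R]_n) i j| <= 1.
Proof. by rewrite mxE; case: eqP => _; rewrite ?normr1 ?normr0. Qed.

Lemma entry_exp_le A k i j : `|(A ^+ k) i j| <= abs_sum A ^+ k.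
Proof.
rewrite -[A ^+ k]mulr1 -[abs_sum A ^+ k]mulr1.
exact: entry_exp_mul_le entry1_le i j.
Qed.

Lemma is_cvg_expmx_psum_entry A i j : cvgn (fun K => expmx_psum A K i j).
Proof.
have -> : (fun K => expmx_psum A K i j) =
    series (fun k => (k`!%:R)^-1 * (A ^+ k) i j).
  apply/funext => K; rewrite /series /= big_mkord /expmx_psum summxE.
  by apply: eq_bigr => k _; rewrite mxE.
apply: normed_cvg; apply: series_le_cvg (is_cvg_series_exp_coeff (abs_sum A)).
- by move=> k; exact: normr_ge0.
- by move=> k; apply: exp_coeff_ge0; exact: abs_sum_ge0.
- move=> k; rewrite exp_coeffE /= normrM ger0_norm ?invr_ge0//.
  by rewrite ler_wpM2l ?invr_ge0// entry_exp_le.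
Qed.

Lemma expmx_psum_cvg_entry A i j :
  (fun K => expmx_psum A K i j) @ \oo --> expmx A i j.
Proof.
pose L := \matrix_(i, j) limn (fun K => expmx_psum A K i j).
have cL : expmx_psum A @ \oo --> L.
  by apply: cvg_mx_entries => a b; rewrite mxE; exact: is_cvg_expmx_psum_entry.
rewrite /expmx -/(expmx_psum A) (cvg_lim _ cL); last exact: norm_hausdorff.
by rewrite mxE; exact: is_cvg_expmx_psum_entry.
Qed.

Lemma expmx0 : expmx (0 : 'M[R]_n) = 1.
Proof.
apply/matrixP => i j; apply: cvg_unique (@expmx_psum_cvg_entry 0 i j) _ => //.
apply: cvg_near_cst; exists 1%N => // -[//|K] _.
rewrite /expmx_psum big_ord_recl expr0 fact0 invr1 scale1r big1 ?addr0// => k _.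
by rewrite expr0n /= scaler0.
Qed.

End MatrixExponential.

Lemma invfactM_bin {R : realType} (k i : nat) : (i <= k)%N ->
  (k`!%:R)^-1 * 'C(k, i)%:R = ((k - i)`!%:R)^-1 * (i`!%:R)^-1 :> R.
Proof.
move=> ik; have f0 m : (m`!%:R : R) != 0 by rewrite pnatr_eq0 -lt0n fact_gt0.
by rewrite -(bin_fact ik) !natrM; field; rewrite !f0 pnatr_eq0 -lt0n bin_gt0 ik.
Qed.

(** Stated over an arbitrary algebra because [expmxD] uses it twice, for matrices and, through
    [R^o], for the scalars that dominate their entries. In the induction, the new terms are those on
    the diagonal [i + j = K], given by the binomial formula. *)
Lemma exp_psumD {R : realType} (V : algType R) (A B : V) (K : nat) :
  GRing.comm A B ->
  \sum_(k < K) (k`!%:R)^-1 *: (A + B) ^+ k =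
  \sum_(i < K) \sum_(j < K | (i + j < K)%N)
     ((i`!%:R)^-1 * (j`!%:R)^-1) *: (A ^+ i * B ^+ j).
Proof.
move=> cAB; elim: K => [|K IH]; first by rewrite !big_ord0.
rewrite big_ord_recr /= IH addrC [A + B]addrC exprDn_comm; last exact/commr_sym.
pose g i j : V := ((i`!%:R)^-1 * (j`!%:R)^-1) *: (A ^+ i * B ^+ j).
have -> : \sum_(i < K.+1) \sum_(j < K.+1 | (i + j < K.+1)%N) g i j =
   \sum_(i < K.+1) \sum_(j < K.+1 | (i + j == K)%N) g i j +
   \sum_(i < K.+1) \sum_(j < K.+1 | (i + j < K)%N) g i j.
  rewrite -big_split /=; apply: eq_bigr => i _.
  rewrite [LHS]big_mkcond [X in X + _]big_mkcond [X in _ + X]big_mkcond -big_split /=.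
  apply: eq_bigr => j _; rewrite ltnS leq_eqVlt.
  by case: ltngtP => _; rewrite ?addr0 ?add0r.
congr (_ + _).
  rewrite scaler_sumr; apply: eq_bigr => i _.
  have iK : (i <= K)%N by rewrite -ltnS.
  rewrite (big_pred1 (inord (K - i))) => [|j]; last first.
    by rewrite /= -val_eqE /= inordK ?ltnS ?leq_subr//; lia.
  rewrite inordK ?ltnS ?leq_subr// /g -[_ *+ 'C(_, _)]scaler_nat scalerA invfactM_bin// mulrC.
  congr (_ *: _); exact/commr_sym/commrX/commr_sym/commrX.
rewrite big_ord_recr /= [X in _ + X]big_pred0 ?addr0 => [|j]; last by lia.
apply: eq_bigr => i _; rewrite [RHS]big_mkcond big_ord_recr /= ifF; last by lia.
by rewrite addr0 -big_mkcond.
Qed.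

Section MatrixExponentialMorphism.
Context {R : realType} {n : nat}.
Implicit Types A B M : 'M[R]_n.

(* The truncated Cauchy product differs from the truncation at [A + B] by the
   terms with [i + j >= K]; these are dominated by the same terms for the
   scalars [abs_sum A], [abs_sum B], which tend to [0] since
   [expR (a + b) = expR a * expR b]. *)
Lemma expmxD A B : A *m B = B *m A -> expmx (A + B) = expmx A *m expmx B.
Proof.
case: n A B => [|m] A B cAB; first by rewrite !flatmx0.
pose a := abs_sum A; pose b := abs_sum B.
pose e (x : R) K := \sum_(k < K) (k`!%:R)^-1 * x ^+ k.
have ecvg x : e x @ \oo --> expR x.
  have -> : e x = series (exp_coeff x).
    by apply/funext => K; rewrite /series /= big_mkord exp_coeffE.
  exact: is_cvg_series_exp_coeff.
have split_psum (V : algType R) (C D : V) K : GRing.comm C D ->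
  (\sum_(k < K) (k`!%:R)^-1 *: C ^+ k) * (\sum_(k < K) (k`!%:R)^-1 *: D ^+ k)
  - \sum_(k < K) (k`!%:R)^-1 *: (C + D) ^+ k =
  \sum_(i < K) \sum_(j < K | ~~ (i + j < K)%N)
     ((i`!%:R)^-1 * (j`!%:R)^-1) *: (C ^+ i * D ^+ j).
  move=> cCD; rewrite exp_psumD// mulr_suml -sumrB; apply: eq_bigr => i _.
  rewrite mulr_sumr (bigID (fun j : 'I_K => (i + j < K)%N)) /=.
  under eq_bigr => j _ do rewrite -scalerAl -scalerAr scalerA.
  under [X in _ + X - _]eq_bigr => j _ do rewrite -scalerAl -scalerAr scalerA.
  by rewrite addrAC subrr add0r.
apply/matrixP => i j; apply/eqP; rewrite eq_sym -subr_eq0; apply/eqP.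
pose D K := (expmx_psum A K *m expmx_psum B K - expmx_psum (A + B) K) i j.
have DL : D @ \oo --> (expmx A *m expmx B) i j - expmx (A + B) i j.
  rewrite /D; under eq_fun do rewrite 2!mxE.
  under eq_fun do rewrite mxE.
  apply: cvgB; last exact: expmx_psum_cvg_entry.
  rewrite mxE; apply: cvg_big => [|k _].
    by move=> /= x; exact: add_continuous.
  by apply: cvgM; exact: expmx_psum_cvg_entry.
apply: cvg_unique DL _ => //.
have cz : (fun K => e a K * e b K - e (a + b) K) @ \oo --> (0 : R).
  rewrite -(subrr (expR (a + b))) {1}expRD.
  by apply: cvgB => //; apply: cvgM.
apply/norm_cvg0P; apply: squeeze_cvgr _ (cvg_cst 0) cz.
near=> K; rewrite normr_ge0 /= /D mulmxE split_psum //.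
rewrite (split_psum R^o a b K) /=; last exact: mulrC.
rewrite !summxE (le_trans (ler_norm_sum _ _ _))//; apply: ler_sum => k _.
rewrite !summxE (le_trans (ler_norm_sum _ _ _))//; apply: ler_sum => l _.
rewrite mxE normrM ger0_norm; last by rewrite mulr_ge0 ?invr_ge0.
rewrite [leRHS]/GRing.scale /= ler_wpM2l ?mulr_ge0 ?invr_ge0//.
by apply: entry_exp_mul_le => x y; exact: entry_exp_le.
Unshelve. all: end_near. Qed.

End MatrixExponentialMorphism.

(** * Exponential decay for symmetric positive definite matrices *)

Definition sqnorm {R : realType} {n : nat} (v : 'cV[R]_n) : R := \sum_i v i 0 ^+ 2.

Section ExponentialDecay.
Context {R : realType} {n : nat}.
Implicit Types (A B : 'M[R]_n) (v w : 'cV[R]_n).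

Lemma sqnormE v : (v^T *m v) 0 0 = sqnorm v.
Proof. by rewrite mxE; apply: eq_bigr => i _; rewrite mxE expr2. Qed.

Lemma sqnorm_ge0 v : 0 <= sqnorm v.
Proof. by apply: sumr_ge0 => i _; exact: sqr_ge0. Qed.

Lemma entry_sq_le_sqnorm v i : v i 0 ^+ 2 <= sqnorm v.
Proof.
rewrite /sqnorm (bigD1 i)//= lerDl; apply: sumr_ge0 => k _; exact: sqr_ge0.
Qed.

Lemma sqnorm_le v c : (forall i, `|v i 0| <= c) -> sqnorm v <= n%:R * c ^+ 2.
Proof.
move=> h; have -> : n%:R * c ^+ 2 = \sum_(i < n) c ^+ 2.
  by rewrite sumr_const card_ord mulr_natl.
apply: ler_sum => i _; rewrite -real_normK ?num_real// ler_sqr ?nnegrE//.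
exact: le_trans (h i).
Qed.

Lemma sqnorm_mul_le B v : sqnorm (B *m v) <= n%:R * abs_sum B ^+ 2 * sqnorm v.
Proof.
rewrite -[X in _ * X]sqr_sqrtr ?sqnorm_ge0// -mulrA -exprMn.
apply: sqnorm_le => i; apply: entry_mul_le => k l; rewrite ord1.
by rewrite -sqrtr_sqr ler_wsqrtr// entry_sq_le_sqnorm.
Qed.

Variable A : 'M[R]_n.
Hypothesis A_sym : A^T = A.
Hypothesis A_pd : forall v, v != 0 -> 0 < (v^T *m A *m v) 0 0.

(** By symmetry the form of [A^(k+2)] at [v] is the form of [A^k] at [A v]; hence an induction over
    two consecutive exponents. *)
Lemma form_exp_ge0 k v : 0 <= (v^T *m (A ^+ k) *m v) 0 0.
Proof.
suff: (forall v, 0 <= (v^T *m (A ^+ k) *m v) 0 0) /\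
      (forall v, 0 <= (v^T *m (A ^+ k.+1) *m v) 0 0) by case.
elim: k {v} => [|k [IH1 IH2]]; split => v //.
- by rewrite expr0 -[1]/(1%:M) mulmx1 sqnormE sqnorm_ge0.
- rewrite expr1; have [->|v0] := eqVneq v 0; last exact/ltW/A_pd.
  by rewrite mulmx0 mxE.
- have := IH1 (A *m v).
  by rewrite exprS exprSr -!mulmxE trmx_mul A_sym !mulmxA.
Qed.

(** A nonzero row of the left kernel would, transposed, be a nonzero vector at which the form of [A]
    vanishes. *)
Lemma pd_unitmx : A \in unitmx.
Proof.
rewrite -row_free_unit -kermx_eq0; apply/eqP/row_matrixP => i; rewrite row0.
set r := row i _; have rA : r *m A = 0 by rewrite -row_mul mulmx_ker row0.
apply/trmx_inj; rewrite trmx0; apply/eqP/contraT => /A_pd.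
by rewrite trmxK rA mul0mx mxE ltxx.
Qed.

(* The powers of [A] are positive semidefinite, so [e^A >= 1 + A^2/2] as quadratic
   forms, and [A] is injective. *)
Lemma expmx_form_lower :
  exists2 q : R, 1 < q & forall v, q * sqnorm v <= (v^T *m expmx A *m v) 0 0.
Proof.
(* From [v = A^(-1) (A v)] one gets [|v|^2 <= c |A v|^2]; the added 1 keeps [c] positive in every
   case. Then [|v|^2 + |A v|^2 / 2] is at least [(1 + 1/(2c)) |v|^2]. *)
pose c := n%:R * abs_sum (invmx A) ^+ 2 + 1.
have c0 : 0 < c by rewrite ltr_wpDl// mulr_ge0// sqr_ge0.
exists (1 + (2 * c)^-1); first by rewrite ltrDl invr_gt0 mulr_gt0.
move=> v.
have vc : sqnorm v <= c * sqnorm (A *m v).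
  rewrite -{1}(mulKmx pd_unitmx v) (le_trans (sqnorm_mul_le _ _))//.
  by rewrite ler_wpM2r ?sqnorm_ge0// lerDl.
have cv : (fun K => (v^T *m expmx_psum A K *m v) 0 0) @ \oo -->
    (v^T *m expmx A *m v) 0 0.
  under eq_fun do rewrite mxE; rewrite mxE.
  apply: cvg_big => [|k _]; first by move=> /= x; exact: add_continuous.
  apply: cvgM; last exact: cvg_cst.
  under eq_fun do rewrite mxE; rewrite mxE.
  apply: cvg_big => [|l _]; first by move=> /= x; exact: add_continuous.
  by apply: cvgM; [exact: cvg_cst|exact: expmx_psum_cvg_entry].
rewrite -(cvg_lim _ cv)//; apply: limr_ge; first exact: cvgP cv.
(* From three terms on, the partial sum contains the degrees 0 and 2 that are kept; all other terms
   are nonnegative. *)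
exists 3%N => // -[|[|[|K]]]// _.
pose f k := (v^T *m (A ^+ k) *m v) 0 0.
have -> : (v^T *m expmx_psum A K.+3 *m v) 0 0 = \sum_(k < K.+3) (k`!%:R)^-1 * f k.
  rewrite /expmx_psum mulmx_sumr mulmx_suml summxE; apply: eq_bigr => k _.
  by rewrite -scalemxAr -scalemxAl mxE.
have f_ge0 k : 0 <= f k by exact: form_exp_ge0.
have f0 : f 0%N = sqnorm v by rewrite /f expr0 -[1]/(1%:M) mulmx1 sqnormE.
have f2 : f 2%N = sqnorm (A *m v).
  by rewrite -sqnormE trmx_mul A_sym /f expr2 -mulmxE !mulmxA.
have tail : 0 <= \sum_(3 <= k < K.+3) (k`!%:R)^-1 * f k.
  by apply: sumr_ge0 => i _; rewrite mulr_ge0 ?invr_ge0.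
rewrite -(big_mkord xpredT (fun k => (k`!%:R)^-1 * f k)).
rewrite (big_cat_nat (n := 3)) //= big_nat_recr //= big_nat_recr //= big_nat1.
rewrite f0 f2 fact0 invr1 !mul1r mulrDl mul1r -!addrA lerD2l.
have h3 : (2 * c)^-1 * sqnorm v <= 2^-1 * sqnorm (A *m v).
  by rewrite invfM -mulrA ler_wpM2l ?invr_ge0// mulrC ler_pdivrMr// mulrC.
by rewrite (le_trans h3)// addrCA lerDl addr_ge0.
Qed.

(** With [v = e^(-A) w], the lower bound reads [q |v|^2 <= <v, w>]. Expanding [0 <= |w - q v|^2]
    then gives [q^2 |v|^2 <= |w|^2], so [r = q^(-2)] works. *)
Lemma expmxN_contract : exists2 r : R, 0 <= r < 1 &
  forall w, sqnorm (expmx (- A) *m w) <= r * sqnorm w.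
Proof.
have [q q1 hq] := expmx_form_lower.
have q0 : 0 < q by exact: lt_trans q1.
exists (q ^- 2).
  rewrite invr_ge0 exprn_ge0 ?ltW//= invf_lt1 ?exprn_gt0// expr_gt1// ltW//.
move=> w; set v := expmx (- A) *m w.
have vw : expmx A *m v = w.
  by rewrite /v mulmxA -expmxD ?subrr ?expmx0 ?mul1mx// mulmxN mulNmx.
rewrite mulrC ler_pdivlMr ?exprn_gt0// mulrC.
have := hq v; rewrite -mulmxA vw => h.
have := sqnorm_ge0 (w - q *: v).
have -> : sqnorm (w - q *: v) =
    sqnorm w - 2 * q * (v^T *m w) 0 0 + q ^+ 2 * sqnorm v.
  rewrite mxE /sqnorm !mulr_sumr -sumrB -big_split /=; apply: eq_bigr => i _.
  by rewrite !mxE; ring.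
have : q * (q * sqnorm v) <= q * (v^T *m w) 0 0 by rewrite ler_wpM2l// ltW.
lra.
Qed.

Lemma expmx_decay : exists2 r : R, 0 <= r < 1 &
  forall (k : nat) w, sqnorm (expmx ((- (k%:Z))%:~R *: A) *m w) <= r ^+ k * sqnorm w.
Proof.
have [r r01 hr] := expmxN_contract; exists r => // k w.
elim: k => [|k IH].
  by rewrite mulrNz mulr0z oppr0 scale0r expmx0 mul1mx expr0 mul1r.
have -> : (- (k.+1%:Z))%:~R *: A = - A + (- (k%:Z))%:~R *: A.
  by rewrite -addn1 PoszD opprD intrD scalerDl scaleN1r addrC.
rewrite expmxD; last by rewrite -scalemxAr -scalemxAl mulmxN mulNmx.
rewrite -mulmxA (le_trans (hr _))// exprS -mulrA ler_wpM2l//.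
by case/andP: r01.
Qed.

End ExponentialDecay.

(** * Increments and box sums *)

Definition zpt (K : nat) (j : 'I_(2 * K).+1) : int := (j : nat)%:Z - K%:Z.

(** A common normal form for the increments, corner sums, box sums and signed sums below: a sum over
    the cube [[-K, K]^N] with product weights. Any [K] large enough to contain the support will
    do. *)
Definition tensor_sum {R : comNzRingType} {V : lmodType R} {N : nat} (K : nat)
    (c : 'I_N -> int -> R) (F : idx N -> V) : V :=
  \sum_(f : {ffun 'I_N -> 'I_(2 * K).+1})
    (\prod_l c l (zpt (f l))) *: F (fun l => zpt (f l)).

(** The pathwise form of [Delta]: [Delta Z t w] unfolds to [dlt (Z^~ w) t]. *)
Definition dlt {R : comNzRingType} {V : lmodType R} {N : nat} (z : idx N -> V)
    (t : idx N) : V :=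
  \sum_(i : {ffun 'I_N -> bool}) (-1) ^+ (\sum_l (i l : nat)) *: z (subi t i).

(** For [r <= M], the sum over the box [(t - r, t]]. The box is cut out by 0/1 weights, so the index
    type depends on [M] alone and the weights have the product form required by [tensor_sum]. *)
Definition rsum {R : comNzRingType} {V : lmodType R} {N : nat} (M : nat)
    (r : 'I_N -> nat) (F : idx N -> V) (t : idx N) : V :=
  \sum_(u : {ffun 'I_N -> 'I_M}) (\prod_l ((u l < r l)%N : nat)%:R) *:
    F (fun l => t l - (u l : nat)%:Z).

Section TensorSums.
Context {R : comNzRingType} {V : lmodType R} {N : nat}.
Implicit Types (c : 'I_N -> int -> R) (F z : idx N -> V) (t a b : idx N).

Lemma zpt_norm K (j : 'I_(2 * K).+1) : `|zpt j| <= K%:Z.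
Proof. by have := ltn_ord j; rewrite /zpt; lia. Qed.

Lemma zpt_surj K (p : int) : `|p| <= K%:Z -> exists j : 'I_(2 * K).+1, zpt j = p.
Proof.
move=> pK; have h : (`|(p + K%:Z)%R| < (2 * K).+1)%N by lia.
by exists (Ordinal h); rewrite /zpt /=; lia.
Qed.

Lemma zpt_inj K : injective (@zpt K).
Proof. by move=> i j; rewrite /zpt => h; apply: val_inj => /=; lia. Qed.

Lemma sum_zpt K (w : int -> R) p : `|p| <= K%:Z ->
  \sum_(j : 'I_(2 * K).+1) (zpt j == p)%:R * w (zpt j) = w p.
Proof.
move=> /zpt_surj[i <-]; rewrite (bigD1 i)//= eqxx mul1r big1 ?addr0// => j ji.
by rewrite (inj_eq (@zpt_inj K)) (negbTE ji) mul0r.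
Qed.

(** Agreement of the summands on the support of the weights suffices. This allows an inner sum to be
    put in normal form only at points that stay away from the boundary of the cube. *)
Lemma eq_tensor_sum K c c' F F' :
  (forall l p, `|p| <= K%:Z -> c l p = c' l p) ->
  (forall q, (forall l, `|q l| <= K%:Z) -> (forall l, c l (q l) != 0) -> F q = F' q) ->
  tensor_sum K c F = tensor_sum K c' F'.
Proof.
move=> cc' FF'; apply: eq_bigr => f _.
have <- : \prod_l c l (zpt (f l)) = \prod_l c' l (zpt (f l)).
  by apply: eq_bigr => l _; apply: cc'; exact: zpt_norm.
have [h|] := pselect (forall l, c l (zpt (f l)) != 0).
  by rewrite FF'// => l; exact: zpt_norm.
move=> /existsNP[l /negP/negPn/eqP cl].
by rewrite (bigD1 l)//= cl mul0r !scale0r.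
Qed.

(* A sum over a product of finite sets depends only on the weight that each
   factor puts on each integer; identities between such sums are thereby
   reduced to one dimension. *)
Lemma sum_tensor_sum (I : finType) K (w : 'I_N -> I -> R) (o : 'I_N -> I -> int) F :
  (forall l x, w l x != 0 -> `|o l x| <= K%:Z) ->
  \sum_(f : {ffun 'I_N -> I}) (\prod_l w l (f l)) *: F (fun l => o l (f l)) =
  tensor_sum K (fun l p => \sum_x w l x * (o l x == p)%:R) F.
Proof.
move=> wK; rewrite /tensor_sum.
under [RHS]eq_bigr => g _ do rewrite bigA_distr_bigA scaler_suml.
rewrite exchange_big /=; apply: eq_bigr => f _.
under [RHS]eq_bigr => g _ do rewrite big_split /= -scalerA.
rewrite -scaler_sumr.
have [h|] := pselect (forall l, w l (f l) != 0); last first.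
  by move=> /existsNP[l /negP/negPn/eqP wl]; rewrite (bigD1 l)//= wl mul0r !scale0r.
congr (_ *: _).
have [g0 g0E] : {g0 : {ffun 'I_N -> 'I_(2 * K).+1} | forall l, zpt (g0 l) = o l (f l)}.
  have /all_sig[g gE] l : {j : 'I_(2 * K).+1 | zpt j = o l (f l)}.
    by apply/cid/zpt_surj/wK.
  by exists (finfun g) => l; rewrite ffunE.
rewrite (bigD1 g0)//= [X in _ + X]big1 ?addr0.
  rewrite big1 ?scale1r => [|l _]; last by rewrite g0E eqxx.
  by congr F; apply/funext => l; rewrite g0E.
move=> g gg0; have [l gl] : exists l, g l != g0 l.
  by apply/existsP; apply: contraR gg0 => /existsPn h'; apply/eqP/ffunP => l; apply/eqP/negPn.
rewrite (bigD1 l)//= -g0E (inj_eq (@zpt_inj K)) eq_sym (negbTE gl) mul0r scale0r//.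
Qed.

(** Product kernels compose coordinate by coordinate, like tensor products of matrices. *)
Lemma tensor_sum_comp K c (k : 'I_N -> int -> int -> R) F :
  tensor_sum K c (fun q => tensor_sum K (fun l => k l (q l)) F) =
  tensor_sum K (fun l p => \sum_(j : 'I_(2 * K).+1) c l (zpt j) * k l (zpt j) p) F.
Proof.
rewrite /tensor_sum.
under [RHS]eq_bigr => g _ do rewrite bigA_distr_bigA scaler_suml.
rewrite [RHS]exchange_big /=; apply: eq_bigr => f _.
rewrite scaler_sumr; apply: eq_bigr => g _.
by rewrite big_split /= scalerA.
Qed.

Lemma signr_sum (i : {ffun 'I_N -> bool}) :
  (-1) ^+ (\sum_l (i l : nat)) = \prod_l (-1) ^+ i l :> R.
Proof. by rewrite prodrXr. Qed.

Lemma corner_tensor_sum K (hi lo : idx N) F :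
  (forall l, `|hi l| <= K%:Z) -> (forall l, `|lo l| <= K%:Z) ->
  \sum_(i : {ffun 'I_N -> bool}) (-1) ^+ (\sum_l (i l : nat)) *:
     F (fun l => if i l then lo l else hi l) =
  tensor_sum K (fun l p => (hi l == p)%:R - (lo l == p)%:R) F.
Proof.
move=> hK lK; under eq_bigr => i _ do rewrite signr_sum.
rewrite (@sum_tensor_sum bool K (fun _ (b : bool) => (-1) ^+ b)
  (fun l (b : bool) => if b then lo l else hi l)); last by move=> l [].
apply: eq_tensor_sum => // l p _.
by rewrite big_bool /= expr0 expr1 mul1r mulN1r addrC.
Qed.

Lemma dlt_tensor_sum K z t : (forall l, `|t l| < K%:Z) ->
  dlt z t = tensor_sum K (fun l p => (t l == p)%:R - (t l - 1 == p)%:R) z.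
Proof.
move=> tK; rewrite -(@corner_tensor_sum K t (fun l => t l - 1)); last 2 first.
- by move=> l; exact/ltW.
- by move=> l; have := tK l; lia.
apply: eq_bigr => i _; congr (_ *: z _); apply/funext => l; rewrite /subi.
by case: (i l); rewrite ?subr0.
Qed.

Lemma rsum_tensor_sum K M (r : 'I_N -> nat) F t : (forall l, (r l <= M)%N) ->
  (forall l, `|t l| + (r l)%:Z <= K%:Z) ->
  rsum M r F t = tensor_sum K (fun l p => (t l - (r l)%:Z < p <= t l)%R%:R) F.
Proof.
move=> rM rK.
rewrite /rsum (@sum_tensor_sum 'I_M K (fun l (x : 'I_M) => ((x < r l)%N : nat)%:R)
  (fun l x => t l - (x : nat)%:Z)); last first.
  by move=> l x; case: ltnP => //= [xr _|]; [have := rK l; lia|rewrite eqxx].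
apply: eq_tensor_sum => // l p _.
have [/andP[h1 h2]|h] := boolP (t l - (r l)%:Z < p <= t l).
  have h : (`|(t l - p)%R| < M)%N by have := rM l; lia.
  rewrite (bigD1 (Ordinal h))//= big1 ?addr0.
    by rewrite (_ : (_ < r l)%N) 1?(_ : (_ == p)) ?mulr1//; lia.
  move=> i ih; rewrite (_ : (_ == p) = false) ?mulr0//.
  by apply: contraNF ih => /eqP ih; apply/eqP/val_inj => /=; lia.
rewrite big1// => x _; case: ltnP => xr; last by rewrite mul0r.
by rewrite (_ : (_ == p) = false) ?mulr0//; apply: contraNF h => /eqP <-; lia.
Qed.

Definition idx_bound (t : idx N) (r : 'I_N -> nat) : nat := \sum_l (`|t l| + r l)%N.

Lemma idx_boundP t r l : `|t l| + (r l)%:Z <= (idx_bound t r)%:Z.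
Proof.
have : (`|t l| + r l <= idx_bound t r)%N by rewrite /idx_bound (bigD1 l)//= leq_addr.
lia.
Qed.

(** Telescoping: in one dimension, the indicator of [(t - r, t]] composed with the difference kernel
    leaves the point mass at [t] minus the one at [t - r]. *)
Lemma rsum_dlt M (r : 'I_N -> nat) z t : (forall l, (r l <= M)%N) ->
  rsum M r (dlt z) t =
  \sum_(i : {ffun 'I_N -> bool}) (-1) ^+ (\sum_l (i l : nat)) *:
     z (fun l => t l - (if i l then (r l)%:Z else 0)).
Proof.
move=> rM; pose K := (idx_bound t r + 2)%N.
have hK l := idx_boundP t r l.
rewrite (@rsum_tensor_sum K)//; last by move=> l; have := hK l; rewrite /K; lia.
transitivity (\sum_(i : {ffun 'I_N -> bool}) (-1) ^+ (\sum_l (i l : nat)) *: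
     z (fun l => if i l then t l - (r l)%:Z else t l)); last first.
  apply: eq_bigr => i _; congr (_ *: z _); apply/funext => l.
  by case: (i l); rewrite ?subr0.
rewrite (@corner_tensor_sum K); last 2 first.
- by move=> l; have := hK l; rewrite /K; lia.
- by move=> l; have := hK l; rewrite /K; lia.
pose k (_ : 'I_N) (q p : int) : R := (q == p)%:R - (q - 1 == p)%:R.
transitivity (tensor_sum K (fun l p => (t l - (r l)%:Z < p <= t l)%R%:R)
   (fun q => tensor_sum K (fun l => k l (q l)) z)).
  apply: eq_tensor_sum => // q _ hq; apply: dlt_tensor_sum => l.
  have := hq l; have [qt _|_] := boolP (t l - (r l)%:Z < q l <= t l); last by rewrite eqxx.
  by have := hK l; rewrite /K; lia.
rewrite tensor_sum_comp; apply: eq_tensor_sum => // l p pK.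
rewrite /k; under eq_bigr => j _ do rewrite mulrC mulrBl.
rewrite sumrB (@sum_zpt K (fun q => (t l - (r l)%:Z < q <= t l)%R%:R))//.
under eq_bigr => j _ do rewrite subr_eq.
(* [sum_zpt] needs its point inside the cube. For [p = K] the point [p + 1] lies outside and the sum
   is empty; the margin 2 in [K] makes all other indicators vanish there too. *)
have [p1K|p1K] := boolP (`|p + 1| <= K%:Z); last first.
  rewrite big1 => [|j _]; last first.
    rewrite (_ : (_ == _) = false) ?mul0r//.
    by apply: contraNF p1K => /eqP <-; exact: zpt_norm.
  have := hK l; move: pK p1K; rewrite /K subr0 => pK p1K hKl.
  by rewrite (_ : (t l == p) = false) 1?(_ : (_ == p) = false) 1?(_ : (_ < _ <= _) = false) ?subr0//; lia.
rewrite (@sum_zpt K (fun q => (t l - (r l)%:Z < q <= t l)%R%:R))//.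
have [|?] := eqVneq (t l) p; have [|?] := eqVneq (t l - (r l)%:Z) p.
all: have [] := boolP (t l - (r l)%:Z < p <= t l).
all: have [] := boolP (t l - (r l)%:Z < p + 1 <= t l).
all: rewrite /= ?(subrr, subr0, sub0r)//; lia.
Qed.

(** The maximum with 0 accounts for a range that is empty in some coordinate, where both sums
    vanish. *)
Lemma boxsum_rsum M (r : 'I_N -> nat) F a t : (forall l, (r l <= M)%N) ->
  (forall l, (r l)%:Z = Num.max 0 (t l - a l + 1)) -> boxsum a t F = rsum M r F t.
Proof.
move=> rM ra; pose K := (idx_bound t r + \sum_l `|a l|)%N.
have hK l : `|t l| + (r l)%:Z + `|a l| <= K%:Z.
  have := idx_boundP t r l.
  have : (`|a l| <= \sum_l `|a l|)%N by rewrite (bigD1 l)//= leq_addr.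
  by rewrite /K; lia.
rewrite (@rsum_tensor_sum K)//; last by move=> l; have := hK l; lia.
rewrite /boxsum; set B := (\max_(l < N) _)%N.
have hB l : (`|t l - a l| <= B)%N by exact: (leq_bigmax l).
transitivity (\sum_(k : {ffun 'I_N -> 'I_B.+1})
    (\prod_l (a l + (k l : nat)%:Z <= t l)%R%:R) *: F (fun l => a l + (k l : nat)%:Z)).
  rewrite big_mkcond; apply: eq_bigr => k _; case: ifP => [/forallP h|].
    by rewrite big1 ?scale1r// => l _; rewrite h.
  move=> /negbT/forallPn[l /negbTE h].
  by rewrite (bigD1 l)//= h mul0r scale0r.
rewrite (@sum_tensor_sum 'I_B.+1 K (fun l (k : 'I_B.+1) => (a l + (k : nat)%:Z <= t l)%R%:R)
   (fun l (k : 'I_B.+1) => a l + (k : nat)%:Z)); last first.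
  by move=> l x; have := hK l; case: (lerP (a l + _)) => //=; [lia|rewrite eqxx].
apply: eq_tensor_sum => // l p _; have ral := ra l; have hBl := hB l.
have [/andP[h1 h2]|h] := boolP (t l - (r l)%:Z < p <= t l).
  have h : (`|(p - a l)%R| < B.+1)%N by lia.
  rewrite (bigD1 (Ordinal h))//= big1 ?addr0.
    by rewrite (_ : (_ <= t l)%R) 1?(_ : (_ == p)) ?mulr1//; lia.
  move=> i ih; rewrite (_ : (_ == p) = false) ?mulr0//.
  by apply: contraNF ih => /eqP ih; apply/eqP/val_inj => /=; lia.
rewrite big1// => x _; case: lerP => xr; last by rewrite mul0r.
by rewrite (_ : (_ == p) = false) ?mulr0//; apply: contraNF h => /eqP <-; lia.
Qed.

End TensorSums.

(** The summation part of [Mtheta]: an oriented discrete integral from 0 to [t] in each coordinate,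
    the sign counting the coordinates that are traversed backwards. *)
Definition sprim {R : comNzRingType} {V : lmodType R} {N : nat} (F : idx N -> V)
    (t : idx N) : V :=
  (-1) ^+ #|[set l : 'I_N | t l < 0]| *:
    boxsum (fun l => if 0 <= t l then 1 else t l + 1)
           (fun l => if 0 <= t l then t l else 0) F.

Section SummationOperator.
Context {R : comNzRingType} {V : lmodType R} {N : nat}.
Implicit Types (F z : idx N -> V) (t : idx N).

(** The one-dimensional content of [dlt_sprim]: thanks to the sign, the discrete fundamental theorem
    also holds across 0. *)
Lemma sprim_kernel_diff (x p : int) :
  (-1) ^+ (x < 0)%R * (Num.min 0 x < p <= Num.max 0 x)%R%:R -
  (-1) ^+ (x - 1 < 0)%R * (Num.min 0 (x - 1) < p <= Num.max 0 (x - 1))%R%:R =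
  (x == p)%:R :> R.
Proof.
have [h1|h1] := boolP (x < 0); have [h2|h2] := boolP (x - 1 < 0).
all: have [] := boolP (Num.min 0 x < p <= Num.max 0 x).
all: have [] := boolP (Num.min 0 (x - 1) < p <= Num.max 0 (x - 1)).
all: have [] := eqVneq x p.
all: rewrite /= ?(mulr0n, mulr1n, expr0, expr1, mulr1, mulr0, mul1r)//.
all: rewrite ?(oppr0, opprK, subrr, addNr, subr0, add0r)//; lia.
Qed.

Lemma card_neg t : #|[set l : 'I_N | t l < 0]| = (\sum_l ((t l < 0)%R : nat))%N.
Proof.
rewrite -sum1_card big_mkcond; apply: eq_bigr => l _.
have -> : (l \in [set l0 | t l0 < 0]) = (t l < 0); last by case: (t l < 0).
by apply/idP/idP; rewrite inE.
Qed.

Lemma sprim_rsum M F t : (forall l, (`|t l| <= M)%N) ->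
  sprim F t = (-1) ^+ (\sum_l ((t l < 0)%R : nat))%N *:
    rsum M (fun l => `|t l|%N) F (fun l => if 0 <= t l then t l else 0).
Proof.
move=> tM; rewrite /sprim card_neg (@boxsum_rsum _ _ _ M (fun l => `|t l|%N))// => l.
by case: ifP; lia.
Qed.

Lemma sprim_tensor_sum K F t : (forall l, `|t l| + `|t l| <= K%:Z) ->
  sprim F t = tensor_sum K
    (fun l p => (-1) ^+ (t l < 0)%R * (Num.min 0 (t l) < p <= Num.max 0 (t l))%R%:R) F.
Proof.
move=> tK; rewrite (@sprim_rsum K)//; last by move=> l; have := tK l; lia.
rewrite (@rsum_tensor_sum _ _ _ K); last 2 first.
- by move=> l; have := tK l; lia.
- by move=> l; have := tK l; case: ifP; lia.
rewrite -prodrXr /tensor_sum scaler_sumr; apply: eq_bigr => f _.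
rewrite scalerA -big_split /=; congr (_ *: _); apply: eq_bigr => l _.
by congr (_ * _%:R); congr nat_of_bool; case: ifP; lia.
Qed.

Lemma dlt_sprim F t : dlt (sprim F) t = F t.
Proof.
(* [sprim_tensor_sum] asks for [2 |q_l| <= K] at [q_l = t_l] and at [q_l = t_l - 1]. *)
pose K := (2 * idx_bound t (fun=> 0%N) + 4)%N.
have hK l := idx_boundP t (fun=> 0%N) l.
pose k (_ : 'I_N) (q p : int) : R :=
  (-1) ^+ (q < 0)%R * (Num.min 0 q < p <= Num.max 0 q)%R%:R.
rewrite (@dlt_tensor_sum _ _ _ K); last by move=> l; have := hK l; rewrite /K; lia.
transitivity (tensor_sum K (fun l p => (t l == p)%:R - (t l - 1 == p)%:R)
   (fun q => tensor_sum K (fun l => k l (q l)) F)).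
  apply: eq_tensor_sum => // q _ hq; apply: sprim_tensor_sum => l.
  have := hq l; have := hK l.
  have [<-|?] := eqVneq (t l) (q l); first by rewrite /K; lia.
  have [<-|?] := eqVneq (t l - 1) (q l); last by rewrite subrr eqxx.
  by rewrite /K; lia.
rewrite tensor_sum_comp.
(* The point mass at [t_l] is written as a sum over one element, so that [sum_tensor_sum] read
   backwards evaluates the result to [F t]. *)
transitivity (tensor_sum K (fun l p => \sum_(x : unit) 1 * (t l == p)%:R) F).
  apply: eq_tensor_sum => // l p pK.
  under eq_bigr => j _ do rewrite mulrBl eq_sym [t l - 1 == _]eq_sym.
  have := hK l => hKl.
  rewrite sumrB (@sum_zpt _ K (fun q => k l q p)); last by rewrite /K; lia.
  rewrite (@sum_zpt _ K (fun q => k l q p)); last by rewrite /K; lia.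
  rewrite big_const /= card_unit /= addr0 mul1r /k.
  by rewrite sprim_kernel_diff.
rewrite -(@sum_tensor_sum _ _ _ unit K (fun _ _ => 1) (fun l _ => t l)); last first.
  by move=> l _ _; have := hK l; rewrite /K; lia.
rewrite (big_pred1 [ffun=> tt]) => [|f]; first by rewrite big1 ?scale1r.
by symmetry; apply/eqP/ffunP => l; case: (f l); rewrite ffunE.
Qed.

Lemma sprim_axis F t : (exists l, t l = 0) -> sprim F t = 0.
Proof.
move=> [l tl]; rewrite (@sprim_rsum (\sum_l `|t l|)%N) => [|l']; last first.
  by rewrite (bigD1 l')//= leq_addr.
rewrite /rsum [X in _ *: X]big1 ?scaler0// => u _.
by rewrite (bigD1 l)//= tl absz0 ltn0 mul0r scale0r.
Qed.

(** Telescoping over the box between 0 and [t] leaves its corners, and every corner other than [t]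
    has a zero coordinate. The corner [t] is a lower one exactly in the negative coordinates, so its
    sign cancels the one in [sprim]. *)
Lemma sprim_dlt z t : (forall s, (exists l, s l = 0) -> z s = 0) ->
  sprim (dlt z) t = z t.
Proof.
move=> z0; rewrite (@sprim_rsum (\sum_l `|t l|)%N) => [|l']; last first.
  by rewrite (bigD1 l')//= leq_addr.
rewrite rsum_dlt => [|l']; last by rewrite (bigD1 l')//= leq_addr.
rewrite (bigD1 [ffun l => t l < 0])//= [X in _ + X]big1 ?addr0 => [|i ine].
  under [in X in _ *: (_ ^+ X *: _)]eq_bigr => l _ do rewrite ffunE.
  rewrite scalerA -exprD addnn -signr_odd odd_double expr0 scale1r.
  by congr z; apply/funext => l; rewrite ffunE; case: ifP; case: ifP; lia.
have [l il] : exists l, i l != (t l < 0).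
  apply/existsP; apply: contraR ine => /existsPn h; apply/eqP/ffunP => l.
  by rewrite ffunE; apply/eqP/negPn.
rewrite z0 ?scaler0//; exists l; move: il; case: (i l); case: ifP; lia.
Qed.

End SummationOperator.

(** * Laws and convergence in probability *)

Section FiniteUnions.
Context {d : measure_display} {T : measurableType d}.

Lemma measurable_forall (I : finType) (A : I -> set T) :
  (forall i, measurable (A i)) -> measurable [set w | forall i, A i w].
Proof.
move=> mA; rewrite (_ : [set w | _] = \bigcap_(i in [set: I]) A i).
  exact: fin_bigcap_measurable.
by apply/seteqP; split => w /= h i //; exact: h.
Qed.

Lemma measurable_exists (I : finType) (A : I -> set T) :
  (forall i, measurable (A i)) -> measurable [set w | exists i, A i w].
Proof.
move=> mA; rewrite (_ : [set w | _] = \bigcup_(i in [set: I]) A i).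
  exact: fin_bigcup_measurable.
by apply/seteqP; split => w /= [i]; [exists i|exists i].
Qed.

Context {R : realType} (P : probability T R).

Lemma prob_exists_le (I : finType) (A : I -> set T) :
  (forall i, measurable (A i)) ->
  (P [set w | exists i, A i w] <= \sum_i P (A i))%E.
Proof.
move=> mA.
have h (s : seq I) : measurable [set w | exists2 i, i \in s & A i w] /\
    (P [set w | exists2 i, i \in s & A i w] <= \sum_(i <- s) P (A i))%E.
  elim: s => [|i s [ms IH]].
    rewrite (_ : [set w | _] = set0); first by rewrite measure0 big_nil.
    by apply/seteqP; split => w //= [].
  rewrite (_ : [set w | _] = A i `|` [set w | exists2 i, i \in s & A i w]).
    split; first exact: measurableU.
    by rewrite big_cons (le_trans (measureU2 _ _ _))// leeD2l.
  apply/seteqP; split => w /=.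
    by move=> [j]; rewrite inE => /predU1P[->|js] Aj; [left|right; exists j].
  by move=> [Ai|[j js Aj]]; [exists i; rewrite ?mem_head|exists j; rewrite // inE js orbT].
have [_] := h (index_enum I); apply: le_trans.
have [ms _] := h (index_enum I); apply: le_measure; rewrite ?inE//.
  exact: measurable_exists.
by move=> w /= [i Ai]; exists i => //; exact: mem_index_enum.
Qed.

(** Z^N is countable: its points are enumerated as finite functions, and countably many null sets
    are merged into one. *)
Lemma ae_forall_idx (N : nat) (Q : idx N -> T -> Prop) :
  (forall t, {ae P, forall w, Q t w}) -> {ae P, forall w, forall t, Q t w}.
Proof.
move=> h.
have : {ae P, forall w, forall m, if unpickle m is Some f then
    Q (fun l => (f : {ffun 'I_N -> int}) l) w else True}.
  apply: ae_foralln => m; case: unpickle => [f|]; first exact: h.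
  exact: aeW.
apply: filterS => w hw t; have := hw (pickle (finfun t)).
by rewrite pickleK (_ : (fun l => _) = t)//; apply/funext => l; rewrite ffunE.
Qed.

End FiniteUnions.

Section RandomVectors.
Context {R : realType} {d : measure_display} {T : measurableType d} {n : nat}.
Implicit Types Z : T -> 'cV[R]_n.

Lemma rvec_sum (I : Type) (s : seq I) (Q : pred I) (Z : I -> T -> 'cV[R]_n) :
  (forall i, rvec (Z i)) -> rvec (fun w => \sum_(i <- s | Q i) Z i w).
Proof.
move=> mZ b; under eq_fun do rewrite summxE.
elim: s => [|i s IH].
  by under eq_fun do rewrite big_nil; exact: measurable_cst.
under eq_fun do rewrite big_cons; case: (Q i) => //.
by apply: measurable_funD => //; exact: mZ.
Qed.

Lemma rvecD Z Z' : rvec Z -> rvec Z' -> rvec (fun w => Z w + Z' w).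
Proof.
move=> mZ mZ' b; under eq_fun do rewrite mxE.
by apply: measurable_funD; [exact: mZ|exact: mZ'].
Qed.

Lemma rvecZ c Z : rvec Z -> rvec (fun w => c *: Z w).
Proof.
move=> mZ b; under eq_fun do rewrite mxE.
by apply: measurable_funM => //; exact: mZ.
Qed.

Lemma rvecB Z Z' : rvec Z -> rvec Z' -> rvec (fun w => Z w - Z' w).
Proof.
move=> mZ mZ'; apply: rvecD => //; under eq_fun do rewrite -scaleN1r.
exact: rvecZ.
Qed.

Lemma rvec_cst v : rvec (fun _ : T => v : 'cV[R]_n).
Proof. by []. Qed.

Lemma rvec_mulmx (A : 'M[R]_n) Z : rvec Z -> rvec (fun w => A *m Z w).
Proof.
move=> mZ b; under eq_fun do rewrite mxE.
by apply: measurable_sum => k; apply: measurable_funM => //; exact: mZ.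
Qed.

Lemma measurable_norm_gt Z (e : R) : rvec Z -> measurable [set w | e < `|Z w|].
Proof.
move=> mZ; have [e0|e0] := ltP e 0.
  rewrite (_ : [set w | _] = setT)//; apply/seteqP; split => w //= _.
  exact: lt_le_trans e0 _.
rewrite (_ : [set w | _] = ~` [set w | forall b, `|Z w b 0| <= e]).
  apply: measurableC; apply: measurable_forall => b.
  have := @measurableT_comp _ _ _ _ _ _ (@Num.norm _ R) _ _ (@normr_measurable R setT) (mZ b).
  move=> /(_ measurableT `]-oo, e]%classic (measurable_itv _)).
  by rewrite setTI (_ : _ @^-1` _ = [set w | `|Z w b 0| <= e]).
apply/seteqP; split => w /=.
  move=> h1 h2; move: h1; rewrite ltNge => /negP; apply.
  by apply/mx_norm_leP => // i j; rewrite ord1; exact: h2.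
move=> h; rewrite ltNge; apply/negP => /mx_norm_leP => /(_ e0) h'.
by apply: h => b; exact: h'.
Qed.

Context (P : probability T R).

Lemma as_eqP Z Z' : rvec Z -> rvec Z' ->
  as_eq P Z Z' <-> {ae P, forall w, Z w = Z' w}.
Proof.
move=> mZ mZ'; have mS : measurable [set w | Z w <> Z' w].
  rewrite (_ : [set w | _] = [set w | 0 < `|Z w - Z' w|]).
    exact/measurable_norm_gt/rvecB.
  apply/seteqP; split => w /=; rewrite normr_gt0 subr_eq0; first by move/eqP.
  by move/eqP.
split => [h|]; first by exists [set w | Z w <> Z' w]; split.
by move=> /(measure_negligible mS).
Qed.

End RandomVectors.

(** * Laws on path space and linear filters *)

Section Laws.
Context {R : realType} {N n : nat}.

Local Notation path := (idx N -> 'cV[R]_n).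

(** Finite-dimensional closed upper orthants, a pi-system on path space making all coordinates
    measurable. Being closed, an orthant is the decreasing intersection of its widenings, which is
    what limits in probability require. *)
Definition rays : set (set path) :=
  [set A | exists (k : nat) (js : 'I_k -> idx N * 'I_n) (x : 'I_k -> R),
    A = [set z : path | forall a, x a <= z (js a).1 (js a).2 0]].

Lemma rays_setI : setI_closed rays.
Proof.
move=> _ _ [k1 [j1 [x1 ->]]] [k2 [j2 [x2 ->]]].
exists (k1 + k2)%N, (fun a => match fintype.split a with inl i => j1 i | inr i => j2 i end),
  (fun a => match fintype.split a with inl i => x1 i | inr i => x2 i end).
apply/seteqP; split => z /=.
  by move=> [h1 h2] a; case: (fintype.split a).
move=> h; split => a.
  by have := h (unsplit (inl a)); rewrite unsplitK.
by have := h (unsplit (inr a)); rewrite unsplitK.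
Qed.

Lemma measurable_coord (t : idx N) (b : 'I_n) :
  measurable_fun setT (fun z : g_sigma_algebraType rays => z t b 0).
Proof.
apply: (measurability (@RGenCInfty.G R)); first exact: RGenCInfty.measurableE.
move=> _ [_ [x ->] <-]; rewrite setTI; apply: sub_sigma_algebra.
exists 1%N, (fun=> (t, b)), (fun=> x); apply/seteqP; split => z /=.
  by rewrite in_itv /= andbT.
by move=> /(_ ord0); rewrite in_itv /= andbT.
Qed.

Context {d : measure_display} {T : measurableType d} (P : probability T R).
Implicit Types X Y : idx N -> T -> 'cV[R]_n.

Definition eq_rays X Y : Prop :=
  forall (k : nat) (js : 'I_k -> idx N * 'I_n) (x : 'I_k -> R),
  P [set w | forall a, x a <= X (js a).1 w (js a).2 0] =
  P [set w | forall a, x a <= Y (js a).1 w (js a).2 0].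

Lemma measurable_path X : rfield X ->
  measurable_fun setT ((fun w => X^~ w) : T -> g_sigma_algebraType rays).
Proof.
move=> mX; apply: (@measurability _ _ T (g_sigma_algebraType rays) setT _ rays) => //.
move=> _ [_ [k [js [x ->]]] <-]; rewrite setTI.
apply: (@measurable_forall _ _ _ (fun a => [set w | x a <= X (js a).1 w (js a).2 0])) => a.
have := mX (js a).1 (js a).2 measurableT `[x a, +oo[%classic (measurable_itv _).
rewrite setTI; congr measurable; apply/seteqP; split => w /=; by rewrite in_itv /= andbT.
Qed.

Lemma measurable_path_event X (A : set path) : rfield X -> <<s rays>> A ->
  measurable [set w | A (X^~ w)].
Proof. by move=> mX mA; have := measurable_path mX measurableT mA; rewrite setTI. Qed.

(** Dynkin's pi-lambda argument: the events of equal probability are stable under proper differences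
    and increasing unions. *)
Lemma eq_rays_law X Y : rfield X -> rfield Y -> eq_rays X Y ->
  forall A : set path, <<s rays>> A -> P [set w | A (X^~ w)] = P [set w | A (Y^~ w)].
Proof.
move=> mX mY eXY.
pose H := [set A : set path | <<s rays>> A /\ P [set w | A (X^~ w)] = P [set w | A (Y^~ w)]].
suff sH : <<s rays>> `<=` H by move=> A /sH[].
apply: lambda_system_subset => //; first exact: rays_setI.
- split => //.
  + split; first by have := @measurableT _ (g_sigma_algebraType rays).
    by congr (P _); apply/seteqP; split.
  + move=> A B BA [mA eA] [mB eB]; split.
      exact: (@measurableD _ (g_sigma_algebraType rays)).
    have e Z : rfield Z -> P [set w | (A `\` B) (Z^~ w)] =
        (P [set w | A (Z^~ w)] - P [set w | B (Z^~ w)])%E.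
      move=> mZ; have := @measureD _ _ _ P _ _ (measurable_path_event mZ mA) (measurable_path_event mZ mB).
      rewrite (setIidr (_ : [set w | B (Z^~ w)] `<=` [set w | A (Z^~ w)])).
        by move=> <- //; rewrite (le_lt_trans (probability_le1 _ _)) ?ltry//; exact: measurable_path_event.
      by move=> w /=; exact: BA.
    by rewrite !e// eA eB.
  + move=> F ndF HF; split.
      by apply: (@bigcup_measurable _ (g_sigma_algebraType rays)) => i _; case: (HF i).
    have e Z : rfield Z -> (fun i => P [set w | F i (Z^~ w)]) @ \oo -->
        P [set w | (\bigcup_i F i) (Z^~ w)].
      move=> mZ; apply: (@nondecreasing_cvg_mu _ _ _ P (fun i => [set w | F i (Z^~ w)])).
      * by move=> i; apply: measurable_path_event => //; case: (HF i).
      * apply: bigcup_measurable => i _.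
        by apply: measurable_path_event => //; case: (HF i).
      * by move=> i j ij; apply/subsetPset => w /=; have /subsetPset := ndF _ _ ij; apply.
    apply: (cvg_unique _ (e X mX)) => //.
    rewrite (_ : (fun i => _) = fun i => P [set w | F i (Y^~ w)]); last first.
      by apply/funext => i; case: (HF i).
    exact: e.
- move=> _ [k [js [x ->]]]; split; last exact: eXY.
  by apply: sub_sigma_algebra; exists k, js, x.
Qed.

Lemma eq_law_rays X Y : eq_law P X Y -> eq_rays X Y.
Proof.
move=> eXY k js x.
(* Only the component named by [js a] is constrained; the other sides of the rectangle are the whole
   line. *)
pose B a b : set R := if b == (js a).2 then `[x a, +oo[%classic else setT.
have e (Z : idx N -> T -> 'cV[R]_n) : [set w | forall a, x a <= Z (js a).1 w (js a).2 0] =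
    [set w | forall a b, Z (js a).1 w b 0 \in B a b].
  apply/seteqP; split => w /= h a; last first.
    by have := h a (js a).2; rewrite /B eqxx inE /= in_itv /= andbT.
  move=> b; rewrite /B; case: eqP => [->|_]; last by rewrite inE.
  by rewrite inE /= in_itv /= andbT.
rewrite !e; apply: eXY => a b; rewrite /B; case: ifP => _ //.
Qed.

Lemma eq_rays_eq_law X Y : rfield X -> rfield Y -> eq_rays X Y -> eq_law P X Y.
Proof.
move=> mX mY eXY k ts B mB.
apply: (eq_rays_law mX mY eXY (A := [set z : path | forall a b, z (ts a) b 0 \in B a b])).
apply: (@measurable_forall _ (g_sigma_algebraType rays) _
  (fun a => [set z : path | forall b, z (ts a) b 0 \in B a b])) => a.
apply: (@measurable_forall _ (g_sigma_algebraType rays) _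
  (fun b => [set z : path | z (ts a) b 0 \in B a b])) => b.
have := @measurable_coord (ts a) b measurableT _ (mB a b); rewrite setTI.
by congr measurable; apply/seteqP; split => z /=; rewrite inE.
Qed.

Lemma eq_law_map (Phi : path -> path) X Y : rfield X -> rfield Y ->
  (forall t b, measurable_fun setT (fun z : g_sigma_algebraType rays => Phi z t b 0)) ->
  eq_law P X Y ->
  eq_law P (fun t w => Phi (X^~ w) t) (fun t w => Phi (Y^~ w) t).
Proof.
move=> mX mY mPhi /eq_law_rays eXY k ts B mB.
apply: (eq_rays_law mX mY eXY (A := [set z : path | forall a b, Phi z (ts a) b 0 \in B a b])).
apply: (@measurable_forall _ (g_sigma_algebraType rays) _
  (fun a => [set z : path | forall b, Phi z (ts a) b 0 \in B a b])) => a.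
apply: (@measurable_forall _ (g_sigma_algebraType rays) _
  (fun b => [set z : path | Phi z (ts a) b 0 \in B a b])) => b.
have := mPhi (ts a) b measurableT _ (mB a b); rewrite setTI.
by congr measurable; apply/seteqP; split => z /=; rewrite inE.
Qed.

Lemma rfield_map (Phi : path -> path) X : rfield X ->
  (forall t b, measurable_fun setT (fun z : g_sigma_algebraType rays => Phi z t b 0)) ->
  rfield (fun t w => Phi (X^~ w) t).
Proof.
by move=> mX mPhi t b; apply: (measurableT_comp (mPhi t b)); exact: measurable_path.
Qed.

Definition lin_filter (I : finType) (C : I -> 'M[R]_n) (v : I -> idx N) (z : path) : path :=
  fun t => \sum_i C i *m z (fun l => t l - v i l).

Lemma measurable_lin_filter (I : finType) (C : I -> 'M[R]_n) (v : I -> idx N) t b :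
  measurable_fun setT (fun z : g_sigma_algebraType rays => lin_filter C v z t b 0).
Proof.
rewrite [X in measurable_fun _ X](_ : _ = fun z : g_sigma_algebraType rays =>
    \sum_i \sum_k C i b k * z (fun l => t l - v i l) k 0); last first.
  by apply/funext => z; rewrite summxE; apply: eq_bigr => i _; rewrite mxE.
apply: measurable_sum => i; apply: measurable_sum => k.
by apply: measurable_funM => //; exact: measurable_coord.
Qed.

Lemma rfield_lin_filter (I : finType) (C : I -> 'M[R]_n) (v : I -> idx N) X :
  rfield X -> rfield (fun t w => lin_filter C v (X^~ w) t).
Proof. by move=> mX; apply: rfield_map => // t b; exact: measurable_lin_filter. Qed.

(** The coefficients and displacements do not depend on [t], so the filter commutes with shifts, and
    equal laws are preserved by a measurable map of paths. *)
Lemma stationary_lin_filter (I : finType) (C : I -> 'M[R]_n) (v : I -> idx N) X :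
  rfield X -> stationary P X -> stationary P (fun t w => lin_filter C v (X^~ w) t).
Proof.
move=> mX sX s.
have -> : (fun t w => lin_filter C v (X^~ w) (idx_shift t s)) =
    (fun t w => lin_filter C v ((fun t => X (idx_shift t s))^~ w) t).
  apply/funext => t; apply/funext => w; apply: eq_bigr => i _; congr (_ *m X _ w).
  by apply/funext => l; rewrite /idx_shift addrAC.
apply: (eq_law_map _ mX _ (sX s)).
  by move=> t; exact: mX.
by move=> t b; exact: measurable_lin_filter.
Qed.

End Laws.

(** * Convergence in probability and its compatibility with equality in law *)

Section ConvergenceInProbability.
Context {R : realType} {d : measure_display} {T : measurableType d}
  (P : probability T R) {n : nat}.
Implicit Types (Z : nat -> T -> 'cV[R]_n) (L : T -> 'cV[R]_n).

(** The comparison principle behind the rules that follow: up to a null set, the error event is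
    covered by finitely many events of vanishing probability, and [e'] translates the tolerance. *)
Lemma cvg_prob_le_sum (I : finType) (Zs : I -> nat -> T -> 'cV[R]_n) Z L
    (e' : R -> R) :
  (forall m, rvec (Z m)) -> rvec L -> (forall i m, rvec (Zs i m)) ->
  (forall i, cvg_prob P (Zs i) (fun=> 0)) ->
  (forall e, 0 < e -> 0 < e' e) ->
  (forall e, 0 < e -> \forall m \near \oo,
     {ae P, forall w, e < `|Z m w - L w| -> exists i, e' e < `|Zs i m w|}) ->
  cvg_prob P Z L.
Proof.
move=> mZ mL mZs cZs e'0 h e e0.
pose f i m := P [set w | e' e < `|Zs i m w - 0|].
have cf : (fun m => (\sum_i f i m)%E) @ \oo --> (\sum_(i : I) 0)%E.
  apply: cvg_nnesum => i _; first exact: nearW.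
  exact/cZs/e'0.
rewrite big1// in cf.
apply: squeeze_cvge _ (cvg_cst 0%E) cf.
have := h e e0; apply: filterS => m hm; rewrite measure_ge0 /=.
have mS i : measurable [set w | e' e < `|Zs i m w - 0|].
  by apply: measurable_norm_gt; apply: rvecB.
apply: le_trans (prob_exists_le P mS).
have [Nw [mN N0 sN]] := hm.
apply: (@le_trans _ _ (P ([set w | exists i, e' e < `|Zs i m w - 0|] `|` Nw))).
  apply: le_measure; rewrite ?inE.
  - by apply: measurable_norm_gt; exact: rvecB.
  - by apply: measurableU => //; exact: measurable_exists.
  - move=> w /= ew; have [|nN] := pselect (Nw w); [by right|left].
    have : ~ ~ (e < `|Z m w - L w| -> exists i, e' e < `|Zs i m w|).
      by move=> hw; apply: nN; apply: sN.
    by move=> /contrapT/(_ ew)[i hi]; exists i; rewrite subr0.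
rewrite (le_trans (measureU2 _ _ _))//; first exact: measurable_exists.
by rewrite [X in (_ + X)%E](_ : _ = 0%E) ?adde0.
Qed.

Lemma cvg_prob_ae_near Z Z' L L' :
  (forall m, rvec (Z m)) -> (forall m, rvec (Z' m)) -> rvec L -> rvec L' ->
  (\forall m \near \oo, {ae P, forall w, Z m w = Z' m w}) ->
  {ae P, forall w, L w = L' w} -> cvg_prob P Z L -> cvg_prob P Z' L'.
Proof.
move=> mZ mZ' mL mL' ZZ' LL' cZ.
apply: (@cvg_prob_le_sum unit (fun _ m w => Z m w - L w) _ _ id) => //.
- by move=> _ m; exact: rvecB.
- by move=> _ e e0; under eq_fun do under eq_set do rewrite subr0; exact: cZ.
move=> e e0; near=> m.
have ZZ'm : {ae P, forall w, Z m w = Z' m w} by near: m.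
by apply: filterS2 ZZ'm LL' => w -> -> h; exists tt.
Unshelve. all: end_near. Qed.

Lemma cvg_prob_sub0 Z L : cvg_prob P (fun m w => Z m w - L w) (fun=> 0) -> cvg_prob P Z L.
Proof.
move=> h e e0; have := h e e0.
by under eq_fun do under eq_set do rewrite subr0.
Qed.

Lemma cvg_prob_sum (I : finType) (Zs : I -> nat -> T -> 'cV[R]_n) :
  (forall i m, rvec (Zs i m)) -> (forall i, cvg_prob P (Zs i) (fun=> 0)) ->
  cvg_prob P (fun m w => \sum_i Zs i m w) (fun=> 0).
Proof.
move=> mZs cZs.
(* If every term is at most [e / (#|I| + 1)], the sum stays strictly below [e]; the added 1 also
   covers an empty [I]. *)
apply: (@cvg_prob_le_sum I Zs _ _ (fun e => e / (#|I|%:R + 1))) => //.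
- by move=> m; exact: rvec_sum.
- by move=> e e0; rewrite divr_gt0// ltr_wpDl.
move=> e e0; apply: nearW => m; apply: aeW => w.
rewrite subr0 => h; apply/not_existsP => hi.
have : `|\sum_i Zs i m w| <= \sum_(i : I) e / (#|I|%:R + 1).
  rewrite (le_trans (ler_norm_sum _ _ _))//; apply: ler_sum => i _.
  by have /negP := hi i; rewrite -leNgt.
rewrite sumr_const -[_ *+ #|_|]mulr_natl => h'.
have : e < e * (#|I|%:R / (#|I|%:R + 1)).
  by apply: (lt_le_trans h); apply: (le_trans h'); rewrite mulrCA lexx.
rewrite ltr_pMr// ltr_pdivlMr ?mul1r ?ltr_wpDl//.
by rewrite gtrDl ltr10.
Qed.

Lemma norm_mulmx_le (A : 'M[R]_n) (v : 'cV[R]_n) : `|A *m v| <= abs_sum A * `|v|.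
Proof.
apply/mx_norm_leP; first by rewrite mulr_ge0// abs_sum_ge0.
by apply: entry_mul_le => i j; exact: mx_entry_le_norm.
Qed.

Lemma cvg_prob_mulmx (A : 'M[R]_n) Z : (forall m, rvec (Z m)) ->
  cvg_prob P Z (fun=> 0) -> cvg_prob P (fun m w => A *m Z m w) (fun=> 0).
Proof.
move=> mZ cZ.
have A0 : 0 < abs_sum A + 1 by rewrite ltr_wpDl// abs_sum_ge0.
apply: (@cvg_prob_le_sum unit (fun _ => Z) _ _ (fun e => e / (abs_sum A + 1))) => //.
- by move=> m; exact: rvec_mulmx.
- by move=> e e0; rewrite divr_gt0.
move=> e e0; apply: nearW => m; apply: aeW => w; rewrite subr0 => h; exists tt.
rewrite ltr_pdivrMr// (lt_le_trans h)// (le_trans (norm_mulmx_le _ _))//.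
by rewrite mulrC ler_wpM2l// lerDl.
Qed.

Lemma cvg_prob_comp Z L (f : nat -> nat) : f @ \oo --> \oo ->
  cvg_prob P Z L -> cvg_prob P (fun m => Z (f m)) L.
Proof.
move=> cf cZ e e0; have h := cZ e e0.
by apply: (@cvg_comp _ _ _ f (fun m => P [set w | e < `|Z m w - L w|])) cf h.
Qed.

Context {N : nat}.
Implicit Types X Y : idx N -> T -> 'cV[R]_n.

Lemma measurable_ray_event X (k : nat) (js : 'I_k -> idx N * 'I_n) (x : 'I_k -> R) :
  rfield X -> measurable [set w | forall a, x a <= X (js a).1 w (js a).2 0].
Proof.
move=> mX; apply: (measurable_path_event mX (A := [set z | forall a, x a <= z (js a).1 (js a).2 0])).
by apply: sub_sigma_algebra; exists k, js, x.
Qed.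

(** Passing from [X] to [Xm m], and from [Ym m] to [Y], each widens the orthant by [e] at the cost
    of a vanishing probability. Letting [m] go to infinity and then [e] to 0 gives one inequality;
    exchanging the roles of the fields gives the other. *)
Lemma cvg_prob_ray_le (Xm Ym : nat -> idx N -> T -> 'cV[R]_n) X Y
    (k : nat) (js : 'I_k -> idx N * 'I_n) (x : 'I_k -> R) :
  (forall m, rfield (Xm m)) -> (forall m, rfield (Ym m)) -> rfield X -> rfield Y ->
  (forall t, cvg_prob P (fun m => Xm m t) (X t)) ->
  (forall t, cvg_prob P (fun m => Ym m t) (Y t)) ->
  (forall m, eq_rays P (Xm m) (Ym m)) ->
  (P [set w | forall a, (x a <= X (js a).1 w (js a).2 0)%R] <=
   P [set w | forall a, (x a <= Y (js a).1 w (js a).2 0)%R])%E.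
Proof.
move=> mXm mYm mX mY cX cY eXY.
have step (e : R) : 0 < e ->
    (P [set w | forall a, (x a <= X (js a).1 w (js a).2 0)%R] <=
     P [set w | forall a, (x a - (e + e) <= Y (js a).1 w (js a).2 0)%R])%E.
  move=> e0.
  pose f (Zm : nat -> idx N -> T -> 'cV[R]_n) (Z : idx N -> T -> 'cV[R]_n) m :=
    (\sum_a P [set w | (e < `|Zm m (js a).1 w - Z (js a).1 w|)%R])%E.
  have cf (Zm : nat -> idx N -> T -> 'cV[R]_n) (Z : idx N -> T -> 'cV[R]_n) : (forall t, cvg_prob P (fun m => Zm m t) (Z t)) ->
      f Zm Z @ \oo --> (\sum_(i < k) 0)%E.
    by move=> cZ; apply: cvg_nnesum => i _; [exact: nearW|exact: cZ].
  have bound (Z Z' : idx N -> T -> 'cV[R]_n) (y : 'I_k -> R) : rfield Z -> rfield Z' ->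
      (P [set w | forall a, (y a <= Z (js a).1 w (js a).2 0)%R] <=
       P [set w | forall a, (y a - e <= Z' (js a).1 w (js a).2 0)%R] +
       \sum_a P [set w | (e < `|Z (js a).1 w - Z' (js a).1 w|)%R])%E.
    move=> mZ mZ'.
    have mS a : measurable [set w | e < `|Z (js a).1 w - Z' (js a).1 w|].
      by apply: measurable_norm_gt; apply: rvecB; [exact: mZ|exact: mZ'].
    have mU := @measurable_ray_event _ k js (fun a => y a - e) mZ'.
    apply: le_trans (leeD2l _ (prob_exists_le P mS)).
    apply: le_trans (measureU2 _ mU (measurable_exists mS)).
    apply: le_measure; rewrite ?inE; first exact: measurable_ray_event.
      by apply: measurableU => //; exact: measurable_exists.
    move=> w /= hw; have [?|] := pselect (exists a, e < `|Z (js a).1 w - Z' (js a).1 w|).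
      by right.
    move=> /forallNP h; left => a; have /negP := h a; rewrite -leNgt => h'.
    have := le_trans (mx_entry_le_norm (Z (js a).1 w - Z' (js a).1 w) (js a).2 0) h'.
    by have := hw a; rewrite !mxE ler_norml; lra.
  have cg : (fun m => (P [set w | forall a, (x a - (e + e) <= Y (js a).1 w (js a).2 0)%R] +
     (f Ym Y m + f Xm X m))%E) @ \oo -->
     (P [set w | forall a, (x a - (e + e) <= Y (js a).1 w (js a).2 0)%R] + (0 + 0))%E.
    have := cf Ym Y cY; have := cf Xm X cX; rewrite big1// => cfX cfY.
    apply: cvgeD; [by rewrite adde0 fin_num_adde_defl|exact: cvg_cst|].
    exact: cvgeD.
  rewrite !adde0 in cg; apply: cvge_ge cg; apply: nearW => m.
  apply: (le_trans (bound X (Xm m) x mX (mXm m))).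
  rewrite (eXY m k js (fun a => x a - e)) addeA; apply: leeD.
    have := bound (Ym m) Y (fun a => x a - e) (mYm m) mY.
    by under [in X in (_ <= X + _)%E -> _]eq_set do under eq_forall do rewrite -addrA -opprD.
  rewrite /f le_eqVlt; apply/orP; left; apply/eqP; apply: eq_bigr => a _.
  by under eq_set do rewrite distrC.
(* Continuity from above along [e = 1/(j+1)]: the widened orthant events decrease to the original
   one. *)
pose F (j : nat) := [set w | forall a, x a - (j.+1%:R^-1 + j.+1%:R^-1) <= Y (js a).1 w (js a).2 0].
have cF : P \o F @ \oo --> P (\bigcap_j F j).
  have mF j : measurable (F j) by exact: measurable_ray_event.
  apply: nonincreasing_cvg_mu => //.
  - by rewrite (le_lt_trans (probability_le1 _ _)) ?ltry.
  - exact: bigcap_measurable.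
  - move=> i j ij; apply/subsetPset => w /= h a; apply: le_trans (h a).
    by rewrite lerD2l lerN2 lerD// lef_pV2 ?posrE// ler_nat.
have <- : \bigcap_j F j = [set w | forall a, x a <= Y (js a).1 w (js a).2 0].
  apply/seteqP; split => w /= h; last first.
    move=> j _ a; apply: le_trans (h a).
    by rewrite gerDl oppr_le0 addr_ge0// invr_ge0.
  move=> a; apply/ler_addgt0Pl => e e0.
  pose j := Num.truncn (e / 2)^-1.
  pose u : R := j.+1%:R^-1; have ue : u <= e / 2.
    by rewrite invf_ple ?posrE ?divr_gt0// ltW// truncnS_gt.
  have hu : x a - (u + u) <= Y (js a).1 w (js a).2 0 := h j I a.
  by rewrite -lerBlDl (le_trans _ hu)// lerD2l lerN2 [leRHS]splitr lerD.
apply: cvge_ge cF; apply: nearW => j /=.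
by apply: step; rewrite invr_gt0.
Qed.

Lemma eq_law_cvg_prob (Xm Ym : nat -> idx N -> T -> 'cV[R]_n) X Y :
  (forall m, rfield (Xm m)) -> (forall m, rfield (Ym m)) -> rfield X -> rfield Y ->
  (forall t, cvg_prob P (fun m => Xm m t) (X t)) ->
  (forall t, cvg_prob P (fun m => Ym m t) (Y t)) ->
  (forall m, eq_law P (Xm m) (Ym m)) -> eq_law P X Y.
Proof.
move=> mXm mYm mX mY cX cY eXY; apply: eq_rays_eq_law => // k js x.
apply/eqP; rewrite eq_le; apply/andP; split.
  by apply: (@cvg_prob_ray_le Xm Ym X Y k js x) => // m; exact: eq_law_rays.
apply: (@cvg_prob_ray_le Ym Xm Y X k js x) => // m k' js' x'.
by symmetry; exact: eq_law_rays.
Qed.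

(** An almost sure modification is the limit in probability of a constant sequence. *)
Lemma eq_law_ae X X' Y Y' : rfield X -> rfield X' -> rfield Y -> rfield Y' ->
  (forall t, {ae P, forall w, X t w = X' t w}) ->
  (forall t, {ae P, forall w, Y t w = Y' t w}) ->
  eq_law P X Y -> eq_law P X' Y'.
Proof.
move=> mX mX' mY mY' XX' YY' eXY.
have cst (Z Z' : idx N -> T -> 'cV[R]_n) t : rfield Z -> rfield Z' ->
    {ae P, forall w, Z t w = Z' t w} -> cvg_prob P (fun=> Z t) (Z' t).
  move=> mZ mZ' ZZ'.
  apply: (@cvg_prob_ae_near (fun=> Z' t) _ (Z' t)) => //.
  - by apply: nearW => _; apply: filterS ZZ' => w ->.
  - exact: aeW.
  - move=> e e0; under eq_fun do under eq_set do rewrite subrr normr0.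
    rewrite (_ : [set w | e < 0] = set0) ?measure0; first exact: cvg_cst.
    by apply/seteqP; split => w //=; rewrite ltNge ltW.
by apply: (@eq_law_cvg_prob (fun=> X) (fun=> Y)) => // t; exact: cst.
Qed.

End ConvergenceInProbability.

(** * Stationary fields *)

Section ThetaExponentials.
Context {R : realType} {N n : nat} (Th : 'I_N -> 'M[R]_n).
Hypothesis Th_comm : forall i j, Th i *m Th j = Th j *m Th i.
Implicit Types (t s : idx N) (z : idx N -> 'cV[R]_n).

Definition expTheta t : 'M[R]_n := expmx (tTheta t Th).

Lemma tThetaD t s : tTheta (fun l => t l + s l) Th = tTheta t Th + tTheta s Th.
Proof.
by rewrite /tTheta -big_split; apply: eq_bigr => l _; rewrite /= intrD scalerDl.
Qed.

Lemma tThetaN t : - tTheta t Th = tTheta (fun l => - t l) Th.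
Proof.
by rewrite /tTheta -sumrN; apply: eq_bigr => l _; rewrite mulrNz scaleNr.
Qed.

Lemma tTheta_comm t s : tTheta t Th *m tTheta s Th = tTheta s Th *m tTheta t Th.
Proof.
have e (a b : idx N) : tTheta a Th *m tTheta b Th =
    \sum_i \sum_j ((a i)%:~R * (b j)%:~R) *: (Th i *m Th j).
  rewrite /tTheta mulmx_suml; apply: eq_bigr => i _; rewrite mulmx_sumr.
  by apply: eq_bigr => j _; rewrite -scalemxAr -scalemxAl scalerA mulrC.
rewrite !e exchange_big /=; apply: eq_bigr => i _; apply: eq_bigr => j _.
by rewrite mulrC Th_comm.
Qed.

Lemma expThetaD t s : expTheta (fun l => t l + s l) = expTheta t *m expTheta s.
Proof. by rewrite /expTheta tThetaD expmxD// tTheta_comm. Qed.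

Lemma expThetaN t : expmx (- tTheta t Th) = expTheta (fun l => - t l).
Proof. by rewrite tThetaN. Qed.

Lemma expTheta0 : expTheta (fun=> 0) = 1%:M.
Proof.
rewrite /expTheta (_ : tTheta _ _ = 0) ?expmx0//.
by rewrite /tTheta big1// => l _; rewrite mulr0z scale0r.
Qed.

Lemma expThetaNK t : expTheta (fun l => - t l) *m expTheta t = 1%:M.
Proof.
rewrite -expThetaD (_ : (fun l => _) = fun=> 0) ?expTheta0//.
by apply/funext => l; rewrite addNr.
Qed.

Lemma expTheta_single (j : 'I_N) (m : int) :
  expmx (m%:~R *: Th j) = expTheta (fun l => if l == j then m else 0).
Proof.
rewrite /expTheta /tTheta (bigD1 j)//= eqxx big1 ?addr0// => l /negbTE ->.
by rewrite mulr0z scale0r.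
Qed.

(* [innov z] is [X_t - sum_(i != 0) (-1)^(1+|i|) e^(-i*Theta) X_(t-i)] for [X = z],
   i.e. the increment of [G] prescribed by the recursion. *)
Definition innov z t : 'cV[R]_n :=
  \sum_(i : {ffun 'I_N -> bool}) (-1) ^+ (\sum_l (i l : nat)) *:
    (expmx (- tTheta (idx_of_bits i) Th) *m z (subi t i)).

Lemma mul_expTheta_innov z t :
  expTheta t *m innov z t = dlt (fun s => expTheta s *m z s) t.
Proof.
rewrite /innov mulmx_sumr; apply: eq_bigr => i _.
by rewrite -scalemxAr mulmxA expThetaN -expThetaD.
Qed.

Lemma innovE z t :
  innov z t = expTheta (fun l => - t l) *m dlt (fun s => expTheta s *m z s) t.
Proof. by rewrite -mul_expTheta_innov mulmxA expThetaNK mul1mx. Qed.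

Lemma recursion_innov z t (v : 'cV[R]_n) :
  (z t = \sum_(i : {ffun 'I_N -> bool} | i != [ffun => false])
       (-1) ^+ (1 + \sum_l (i l : nat)) *:
          (expmx (- tTheta (idx_of_bits i) Th) *m z (subi t i)) + v) <->
  v = innov z t.
Proof.
have -> : innov z t = z t - \sum_(i : {ffun 'I_N -> bool} | i != [ffun => false])
       (-1) ^+ (1 + \sum_l (i l : nat)) *:
          (expmx (- tTheta (idx_of_bits i) Th) *m z (subi t i)).
  rewrite /innov (bigD1 [ffun=> false])//=; congr (_ + _).
    rewrite big1 ?expr0 ?scale1r => [|l _]; last by rewrite ffunE.
    rewrite (_ : idx_of_bits _ = fun=> 0).
      rewrite expThetaN (_ : (fun l => _) = fun=> 0) ?expTheta0 ?mul1mx.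
        by congr z; apply/funext => l; rewrite /subi ffunE subr0.
      by apply/funext => l; rewrite oppr0.
    by apply/funext => l; rewrite /idx_of_bits ffunE.
  by rewrite -sumrN; apply: eq_bigr => i _; rewrite exprS mulN1r scaleNr opprK.
split => [{1}->|->]; first by rewrite addrC addKr.
by rewrite addrC subrK.
Qed.

(** The box sum rescaled by [e^(-t*Theta)], after the sides in the directions [l >= k] have become
    infinite and the corners displaced there have vanished. It runs from the full corner sum at
    [k = N] to [z t] at [k = 0]. *)
Definition corner (k : nat) (r : 'I_N -> nat) z t : 'cV[R]_n :=
  \sum_(i : {ffun 'I_N -> bool} | [forall l : 'I_N, i l ==> (l < k)%N])
    (-1) ^+ (\sum_l (i l : nat)) *:
    (expTheta (fun l => - (if i l then (r l)%:Z else 0)) *m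
       z (fun l => t l - (if i l then (r l)%:Z else 0))).

Lemma corner0 r z t : corner 0 r z t = z t.
Proof.
rewrite /corner (big_pred1 [ffun=> false]) => [|i].
  rewrite big1 ?expr0 ?scale1r => [|l _]; last by rewrite ffunE.
  rewrite (_ : (fun l => - _) = fun=> 0) ?expTheta0 ?mul1mx.
    by congr z; apply/funext => l; rewrite ffunE subr0.
  by apply/funext => l; rewrite ffunE oppr0.
apply/forallP/eqP => [h|-> l]; last by rewrite ffunE.
by apply/ffunP => l; rewrite ffunE; have := h l; case: (i l).
Qed.

Lemma eq_corner k r r' z t : (forall l : 'I_N, (l < k)%N -> r l = r' l) ->
  corner k r z t = corner k r' z t.
Proof.
move=> rr'; apply: eq_bigr => i /forallP ik.
have e (l : 'I_N) : (if i l then (r l)%:Z else 0) = (if i l then (r' l)%:Z else 0).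
  by have := ik l; case: (i l) => //= /rr' ->.
by congr (_ *: (expTheta _ *m z _)); apply/funext => l; rewrite e.
Qed.

Lemma cornerS (k : 'I_N) r z t :
  corner k.+1 r z t = corner k r z t +
  \sum_(i : {ffun 'I_N -> bool} | [forall l : 'I_N, i l ==> (l < k.+1)%N] && i k)
    (-1) ^+ (\sum_l (i l : nat)) *:
    (expTheta (fun l => - (if i l then (r l)%:Z else 0)) *m
       z (fun l => t l - (if i l then (r l)%:Z else 0))).
Proof.
rewrite /corner (bigID (fun i : {ffun 'I_N -> bool} => i k)) /= addrC; congr (_ + _).
apply: eq_bigl => i; apply/andP/forallP => [[/forallP h nik] l|h].
  have := h l; case: (boolP (i l)) => //= il.
  rewrite ltnS leq_eqVlt => /orP[/eqP/val_inj e|//].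
  by rewrite -e il in nik.
split; last by apply/negP => ik; have := h k; rewrite ik ltnn.
by apply/forallP => l; have := h l; case: (i l) => //= /ltnW.
Qed.

Lemma corner_full M r z t : (forall l, (r l <= M)%N) ->
  expTheta t *m corner N r z t = rsum M r (dlt (fun s => expTheta s *m z s)) t.
Proof.
move=> rM; rewrite rsum_dlt// /corner mulmx_sumr; apply: eq_big => i.
  by apply/forallP => l; rewrite ltn_ord implybT.
by move=> _; rewrite -scalemxAr mulmxA -expThetaD.
Qed.

(** The factor [e^(-t*Theta)] turns the weight [e^((t-u)*Theta)] of the increment at [t - u] into
    [e^(-u*Theta)], which does not involve [t]. *)
Lemma corner_full_filter M r z t : (forall l, (r l <= M)%N) ->
  corner N r z t =
  lin_filter (fun u : {ffun 'I_N -> 'I_M} =>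
       (\prod_l ((u l < r l)%N : nat)%:R) *: expTheta (fun l => - (u l : nat)%:Z))
    (fun u l => (u l : nat)%:Z) (innov z) t.
Proof.
move=> rM.
have -> : corner N r z t = expTheta (fun l => - t l) *m (expTheta t *m corner N r z t).
  by rewrite mulmxA expThetaNK mul1mx.
rewrite (corner_full _ _ rM) /rsum mulmx_sumr; apply: eq_bigr => u _.
rewrite -scalemxAr -scalemxAl -mul_expTheta_innov mulmxA -expThetaD.
by congr (_ *: (expTheta _ *m _)); apply/funext => l; rewrite addKr.
Qed.

Lemma sprim_innov z t :
  sprim (innov z) t = sprim (fun j => expmx (- tTheta j Th) *m
    dlt (fun s => expTheta s *m z s) j) t.
Proof. by congr sprim; apply/funext => j; rewrite innovE -expThetaN. Qed.

Lemma innov_filter z t : innov z t =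
  lin_filter (fun i : {ffun 'I_N -> bool} => (-1) ^+ (\sum_l (i l : nat)) *:
    expmx (- tTheta (idx_of_bits i) Th)) (fun i => idx_of_bits i) z t.
Proof. by apply: eq_bigr => i _; rewrite -scalemxAl. Qed.

Lemma corner_filter k r z t : corner k r z t =
  lin_filter (fun i : {ffun 'I_N -> bool} =>
    (if [forall l : 'I_N, i l ==> (l < k)%N] then (-1) ^+ (\sum_l (i l : nat)) else 0) *:
    expTheta (fun l => - (if i l then (r l)%:Z else 0)))
    (fun i l => if i l then (r l)%:Z else 0) z t.
Proof.
rewrite /corner big_mkcond; apply: eq_bigr => i _; case: ifP => _.
  by rewrite -scalemxAl.
by rewrite scale0r mul0mx.
Qed.

End ThetaExponentials.

(** * Corner limits under condition (i), and condition (i) for stationary fields *)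

Section StationaryFields.
Context {R : realType} {d : measure_display} {T : measurableType d}
  (P : probability T R) {N n : nat} (Th : 'I_N -> 'M[R]_n).
Hypothesis Th_comm : forall i j, Th i *m Th j = Th j *m Th i.
Implicit Types (X G : idx N -> T -> 'cV[R]_n) (t s : idx N).

Local Notation E := (expTheta Th).

Lemma eq_expTheta_mul (u u' v v' : idx N) (z : idx N -> 'cV[R]_n) :
  u =1 u' -> v =1 v' -> E u *m z v = E u' *m z v'.
Proof. by move=> /funext -> /funext ->. Qed.

Lemma rfield_corner k r X : rfield X -> rfield (fun t w => corner Th k r (X^~ w) t).
Proof.
move=> mX t; under eq_fun do rewrite corner_filter.
exact: rfield_lin_filter.
Qed.

Lemma cond_i_shift X (t : idx N) (j : 'I_N) (f : nat -> nat) (B : 'M[R]_n) :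
  rfield X -> cond_i P Th X -> (forall K, \forall m \near \oo, (K <= f m)%N) ->
  cvg_prob P (fun m w =>
    B *m (E (fun l => if l == j then - (f m)%:Z else 0) *m
      X (fun l => if l == j then t l - (f m)%:Z else t l) w)) (fun=> 0).
Proof.
move=> mX cX finf.
(* Once [f m >= |t_j|], one has [- g m = t_j - f m], the coordinate at which (i) is applied. The
   remaining factor [e^(-t_j Theta_j)] is constant and is absorbed into [C]. *)
pose g m := `|(f m)%:Z - t j|%N.
have cg : g @ \oo --> \oo.
  apply/cvgnyPge => A; apply: filterS (finf (A + `|t j|)%N) => m; rewrite /g; lia.
pose C := B *m E (fun l => if l == j then - t j else 0).
pose Z m w := C *m (expmx ((- (m%:Z))%:~R *: Th j) *m X (updz t j (- (m%:Z))) w).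
have mZ m : rvec (Z m) by apply: rvec_mulmx; apply: rvec_mulmx; exact: mX.
have cZ : cvg_prob P (fun m => Z (g m)) (fun=> 0).
  apply: (cvg_prob_comp (Z := Z)) => //; apply: cvg_prob_mulmx; last exact: cX.
  by move=> m; apply: rvec_mulmx; exact: mX.
apply: cvg_prob_ae_near cZ => //.
- by move=> m; apply: rvec_mulmx; apply: rvec_mulmx; exact: mX.
- apply: filterS (finf `|t j|%N) => m fm; apply: aeW => w.
  rewrite /Z /C -mulmxA; congr (_ *m _); rewrite expTheta_single mulmxA -(expThetaD Th_comm).
  apply: (@eq_expTheta_mul _ _ _ _ (X^~ w)) => l; rewrite ?/updz;
  by case: eqP => [e|_]; rewrite ?e ?addr0 // /g; lia.
- exact: aeW.
Qed.

(** By [cornerS] the difference consists of corners displaced in direction [k], each a fixed matrix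
    times a quantity covered by (i). The side is [f m] because stationarity uses [f = id], while the
    iterated limit uses the side length determined by [M k]. *)
Lemma corner_cvg X (k : 'I_N) (r : 'I_N -> nat) t (f : nat -> nat) :
  rfield X -> cond_i P Th X -> (forall K, \forall m \near \oo, (K <= f m)%N) ->
  cvg_prob P (fun m w => corner Th k.+1 (upd r k (f m)) (X^~ w) t)
    (fun w => corner Th k r (X^~ w) t).
Proof.
move=> mX cX finf; apply: cvg_prob_sub0.
pose Q (i : {ffun 'I_N -> bool}) := [forall l : 'I_N, i l ==> (l < k.+1)%N] && i k.
pose Z (i : {ffun 'I_N -> bool}) m w : 'cV[R]_n := if Q i then
   ((-1) ^+ (\sum_l (i l : nat)) *: E (fun l => if l == k then 0 else - (if i l then (r l)%:Z else 0)))
   *m (E (fun l => if l == k then - (f m)%:Z else 0) *m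
      X (fun l => if l == k then (fun l => t l - (if (l != k) && i l then (r l)%:Z else 0)) l - (f m)%:Z
                  else (fun l => t l - (if (l != k) && i l then (r l)%:Z else 0)) l) w)
   else 0.
rewrite (_ : (fun m w => _) = fun m w => \sum_i Z i m w); last first.
  apply/funext => m; apply/funext => w.
  rewrite cornerS (@eq_corner _ _ _ Th k (upd r k (f m)) r); last first.
    by move=> l lk; rewrite /upd ifF//; apply/eqP => lk'; rewrite lk' ltnn in lk.
  rewrite addrC addKr [LHS]big_mkcond; apply: eq_bigr => i _.
  rewrite /Z -/(Q i); case: ifP => // /andP[_ ik].
  rewrite -scalemxAl mulmxA -(expThetaD Th_comm); congr (_ *: _).
  apply: (@eq_expTheta_mul _ _ _ _ (X^~ w)) => l; rewrite /upd.
    by case: eqP => [->|_]; rewrite ?ik ?add0r ?addr0.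
  by case: eqP => [->|_]; rewrite /= ?ik ?subr0.
apply: cvg_prob_sum => i; rewrite /Z; case: (Q i).
- by move=> m; apply: rvec_mulmx; apply: rvec_mulmx; exact: mX.
- by move=> m; exact: rvec_cst.
- exact: cond_i_shift.
- move=> e e0; under eq_fun do under eq_set do rewrite subrr normr0.
  rewrite (_ : [set w | e < 0] = set0) ?measure0; first exact: cvg_cst.
  by apply/seteqP; split => w //=; rewrite ltNge ltW.
Qed.

Lemma stationary_of_recursion X G : rfield X -> cond_i P Th X -> rfield G ->
  stat_incr P G -> (forall t, {ae P, forall w, Delta G t w = innov Th (X^~ w) t}) ->
  stationary P X.
Proof.
move=> mX cX mG sG GX.
(* Induction on the number [k] of directions already taken to infinity. The sides [r] stay general
   because each step varies one of them. *)
suff h k r : (k <= N)%N -> stationary P (fun t w => corner Th (N - k) r (X^~ w) t).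
  have := h N (fun=> 0%N) (leqnn N); rewrite subnn.
  by rewrite (_ : (fun t w => _) = X)//; apply/funext => t; apply/funext => w; exact: corner0.
elim: k r => [|k IH] r kN s.
  rewrite subn0; pose M := (\sum_l r l)%N.
  have rM l : (r l <= M)%N by rewrite /M (bigD1 l)//= leq_addr.
  have mD : rfield (Delta G).
    by move=> t; apply: rvec_sum => i; apply: rvecZ; exact: mG.
  set C := fun u : {ffun 'I_N -> 'I_M} =>
     (\prod_l ((u l < r l)%N : nat)%:R) *: E (fun l => - (u l : nat)%:Z).
  set v := fun (u : {ffun 'I_N -> 'I_M}) l => (u l : nat)%:Z.
  have mF := @rfield_lin_filter R N n d T _ C v _ mD.
  have e t : {ae P, forall w, lin_filter C v ((Delta G)^~ w) t = corner Th N r (X^~ w) t}.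
    apply: filterS (ae_forall_idx GX) => w hw.
    rewrite (corner_full_filter _ _ _ rM)//; apply: eq_bigr => u _.
    by rewrite hw.
  have sF := @stationary_lin_filter R N n d T P _ C v _ mD (sG : stationary P (Delta G)) s.
  apply: (eq_law_ae _ _ _ _ _ _ sF) => //.
  - by move=> t; exact: rfield_corner.
  - exact: rfield_corner.
have kk : (N - k.+1 < N)%N by lia.
pose k' := Ordinal kk.
have e : (N - k = k'.+1)%N by rewrite /=; lia.
rewrite e in IH.
apply: (@eq_law_cvg_prob _ _ _ P _ _
  (fun m t w => corner Th k'.+1 (upd r k' m) (X^~ w) (idx_shift t s))
  (fun m t w => corner Th k'.+1 (upd r k' m) (X^~ w) t)).
- by move=> m t; exact: rfield_corner.
- by move=> m; exact: rfield_corner.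
- by move=> t; exact: rfield_corner.
- exact: rfield_corner.
- by move=> t; apply: (@corner_cvg X k' r _ id) => // K; exact: nbhs_infty_ge.
- by move=> t; apply: (@corner_cvg X k' r _ id) => // K; exact: nbhs_infty_ge.
- by move=> m; apply: IH; lia.
Qed.

(** The range from [-M_l] to [t_l] has [max 0 (t_l + M_l + 1)] points, which is the side length of
    the box. The partial sums [F] are tied to corner sums only almost surely, as the recursion gives
    no more. *)
Lemma iter_cvg_corner X t (F : ('I_N -> nat) -> T -> 'cV[R]_n) :
  rfield X -> cond_i P Th X -> (forall M, rvec (F M)) ->
  (forall M, {ae P, forall w, F M w =
     E t *m corner Th N (fun l => `|(Num.max 0 (t l + (M l)%:Z + 1))%R|%N) (X^~ w) t}) ->
  exists L, [/\ iter_cvg_prob P F L, rvec L & {ae P, forall w, L w = E t *m X t w}].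
Proof.
move=> mX cX mF FX.
pose q (M : 'I_N -> nat) l := `|(Num.max 0 (t l + (M l)%:Z + 1))%R|%N.
(* [iter_cvg_prob] demands [Ls N = F] exactly, so the top stage is [F] itself and only the lower
   stages are corner sums. *)
pose Ls k M := if (N <= k)%N then F M else
  fun w => E t *m corner Th k (q M) (X^~ w) t.
have mLs k M : rvec (Ls k M).
  by rewrite /Ls; case: ifP => // _; apply: rvec_mulmx; exact: rfield_corner.
have LsM k M M' : (forall l : 'I_N, (l < k)%N -> M l = M' l) -> Ls k M = Ls k M'.
  move=> MM'; rewrite /Ls; case: leqP => kN.
    by congr F; apply/funext => l; apply: MM'; exact: leq_trans kN.
  apply/funext => w; apply: (congr1 (mulmx _)); apply: eq_corner => l lk.
  by rewrite /q MM'.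
have Lsae k M : (k <= N)%N ->
    {ae P, forall w, Ls k M w = E t *m corner Th k (q M) (X^~ w) t}.
  rewrite /Ls leq_eqVlt => /predU1P[->|kN]; first by rewrite leqnn; exact: FX.
  by rewrite leqNgt kN; exact: aeW.
exists (Ls 0%N (fun=> 0%N)); split => //.
- exists Ls; split; [|exact: mLs|exact: LsM| |].
  + by apply/funext => M; rewrite /Ls leqnn.
  + move=> k M.
    pose f m := `|(Num.max 0 (t k + m%:Z + 1))%R|%N.
    have qu m : q (upd M k m) = upd (q M) k (f m).
      by apply/funext => l; rewrite /q /upd; case: eqP => [->|].
    have c : cvg_prob P (fun m w => corner Th k.+1 (q (upd M k m)) (X^~ w) t -
         corner Th k (q M) (X^~ w) t) (fun=> 0).
      have h := @corner_cvg X k (q M) t f mX cX.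
      under eq_fun do under eq_fun do rewrite qu.
      move=> e e0; under eq_fun do under eq_set do rewrite subr0.
      apply: h => // K; exists (K + `|t k|)%N => // m /=; rewrite /f; lia.
    apply: cvg_prob_sub0.
    apply: (@cvg_prob_ae_near _ _ _ P _ (fun m w => E t *m (corner Th k.+1 (q (upd M k m)) (X^~ w) t -
         corner Th k (q M) (X^~ w) t)) _ (fun=> 0)) => //.
    * by move=> m; apply: rvec_mulmx; apply: rvecB; exact: rfield_corner.
    * by move=> m; apply: rvecB; exact: mLs.
    * apply: nearW => m; apply: filterS2 (Lsae k.+1 (upd M k m) (ltn_ord k)) (Lsae k M (ltnW (ltn_ord k))).
      by move=> w -> ->; rewrite mulmxBr.
    * exact: aeW.
    * apply: cvg_prob_mulmx => // m; apply: rvecB; exact: rfield_corner.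
  + by move=> M; exact: LsM.
- apply: filterS (Lsae 0%N (fun=> 0%N) (leq0n N)) => w ->; by rewrite corner0.
Qed.

Lemma Minv_psum_ae X G t : (forall t, {ae P, forall w, Delta G t w = innov Th (X^~ w) t}) ->
  forall M, {ae P, forall w, Minv_psum Th G t M w =
     E t *m corner Th N (fun l => `|(Num.max 0 (t l + (M l)%:Z + 1))%R|%N) (X^~ w) t}.
Proof.
move=> GX M; apply: filterS (ae_forall_idx GX) => w hw.
pose r l := `|(Num.max 0 (t l + (M l)%:Z + 1))%R|%N.
pose K := (\sum_l r l)%N.
have rK l : (r l <= K)%N by rewrite /K (bigD1 l)//= leq_addr.
rewrite (corner_full _ _ _ rK)// /Minv_psum.
rewrite (@boxsum_rsum _ _ _ K r)//; last by move=> l; rewrite /r; lia.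
apply: eq_bigr => u _; congr (_ *: _).
by rewrite hw mul_expTheta_innov.
Qed.

Lemma rvec_Minv_psum G t M : rfield G -> rvec (Minv_psum Th G t M).
Proof.
move=> mG; apply: rvec_sum => k; apply: rvec_mulmx; apply: rvec_sum => i.
by apply: rvecZ; exact: mG.
Qed.

Lemma stationary_cond_i X : (forall j, (Th j)^T = Th j) ->
  (forall j (v : 'cV[R]_n), v != 0 -> 0 < (v^T *m Th j *m v) 0 0) ->
  rfield X -> stationary P X -> cond_i P Th X.
Proof.
move=> Th_sym Th_pd mX sX j t.
have [rho /andP[rho0 rho1] hrho] := expmx_decay (Th_sym j) (Th_pd j).
pose X0 := X (updz t j 0).
pose tail (c : nat) : set T := [set w | c%:R < `|X0 w|].
have mtail c : measurable (tail c) by exact/measurable_norm_gt/mX.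
have ctail : P \o tail @ \oo --> 0%E.
  rewrite -(measure0 P) -(_ : \bigcap_c tail c = set0).
    apply: nonincreasing_cvg_mu => //.
    - by rewrite (le_lt_trans (probability_le1 _ _)) ?ltry.
    - exact: bigcap_measurable.
    - move=> i k ik; apply/subsetPset => w; apply: le_lt_trans.
      by rewrite ler_nat.
  apply/seteqP; split => w //= h.
  have := h (Num.truncn `|X0 w|).+1 I; rewrite /tail /=.
  by rewrite ltNge ltW// truncnS_gt.
have law k c : P [set w | c%:R < `|X (updz t j (- k%:Z)) w|] = P (tail c).
  pose s : idx N := fun l => if l == j then - k%:Z else 0.
  (* For the maximum norm, the event [|X| <= c] is a rectangle, to which [eq_law] applies directly;
     its complement is the tail. *)
  pose B (_ : 'I_1) (_ : 'I_n) : set R := [set` `[- c%:R, c%:R]].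
  have := sX s 1%N (fun=> updz t j 0) B (fun _ _ => measurable_itv _).
  rewrite (_ : idx_shift (updz t j 0) s = updz t j (- k%:Z)); last first.
    by apply/funext => l; rewrite /idx_shift /updz /s; case: eqP; rewrite ?add0r ?addr0.
  have e t' : [set w | forall (a : 'I_1) b, X t' w b 0 \in B a b] =
      ~` [set w | c%:R < `|X t' w|].
    apply/seteqP; split => w /=.
      move=> h; apply/negP; rewrite -leNgt; apply/mx_norm_leP => // b a.
      by rewrite [a]ord1; have := h ord0 b; rewrite inE /B /= in_itv /= -ler_norml.
    move=> /negP; rewrite -leNgt => /(iffLR (mx_norm_leP _ (ler0n R c))) h a b.
    by rewrite inE /B /= in_itv /= -ler_norml h.
  rewrite !e !probability_setC; [|exact/measurable_norm_gt/mX|exact/measurable_norm_gt/mX].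
  move=> /(congr1 (fun x => 1 - x)%E).
  have sub1 (A : set T) : measurable A -> (1 - (1 - P A) = P A)%E.
    move=> mA; have : P A \is a fin_num by exact: fin_num_measure.
    by case: (P A) => // a _; rewrite -!EFinB opprB addrCA subrr addr0.
  by rewrite !sub1//; exact/measurable_norm_gt/mX.
move=> e e0; apply/fine_cvgP; split.
  apply: nearW => k; apply: fin_num_measure.
  by apply: measurable_norm_gt; apply: rvecB => //; apply: rvec_mulmx; exact: mX.
apply/cvgrPdist_le => del del0.
have /fine_cvgP[_ /cvgrPdist_le/(_ del del0)[c _ hc]] := ctail.
have {hc} := hc c (leqnn c).
rewrite sub0r normrN /= => hc.
(* On [|X| <= c] the decay bounds the squared norm by [rho^k n c^2], which is at most [e^2] for
   large [k]. The error event then lies in the tail [c < |X|], whose probability is at most [del]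
   and, by stationarity, the same for all [k]. *)
have crho : (fun k => rho ^+ k * (n%:R * c%:R ^+ 2)) @ \oo --> (0 : R).
  rewrite -[0 in X in _ --> X](mul0r (n%:R * c%:R ^+ 2)).
  by apply: cvgM; [apply: cvg_expr; rewrite ger0_norm|exact: cvg_cst].
have /cvgrPdist_le/(_ _ (exprn_gt0 2 e0)) := crho.
apply: filterS => k; rewrite sub0r normrN => hk.
rewrite sub0r normrN; apply: le_trans hc.
rewrite !ger0_norm ?fine_ge0//.
apply: fine_le; [| |].
- apply: fin_num_measure.
  by apply: measurable_norm_gt; apply: rvecB => //; apply: rvec_mulmx; exact: mX.
- exact: fin_num_measure.
rewrite -(law k c); apply: le_measure; rewrite ?inE.
- by apply: measurable_norm_gt; apply: rvecB => //; apply: rvec_mulmx; exact: mX.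
- exact/measurable_norm_gt/mX.
move=> w /=; rewrite subr0 => h; rewrite ltNge; apply/negP => hX.
move: h; rewrite ltNge => /negP; apply.
apply/mx_norm_leP; first exact: ltW.
move=> i a; rewrite ord1.
rewrite -ler_sqr ?nnegrE ?normr_ge0 ?(ltW e0)// real_normK ?num_real//.
apply: le_trans (entry_sq_le_sqnorm _ _) _; apply: le_trans (hrho _ _) _.
apply: le_trans hk; apply: le_trans (ler_norm _).
rewrite ler_wpM2l ?exprn_ge0//; apply: sqnorm_le => b.
exact: (iffLR (mx_norm_leP _ (ler0n R c)) hX).
Qed.

End StationaryFields.

(** * The field [G] attached to [X], and the equivalence *)

Section MainProof.
Context {R : realType} {d : measure_display} {T : measurableType d}
  (P : probability T R) {N n : nat} (Th : 'I_N -> 'M[R]_n).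
Hypothesis Th_comm : forall i j, Th i *m Th j = Th j *m Th i.
Implicit Types (X G : idx N -> T -> 'cV[R]_n) (t s : idx N).

Lemma rfield_Delta G : rfield G -> rfield (Delta G).
Proof. by move=> mG t; apply: rvec_sum => i; apply: rvecZ; exact: mG. Qed.

Lemma recursion_ae X G : rfield X -> rfield G ->
  recursion P Th X G <-> forall t, {ae P, forall w, Delta G t w = innov Th (X^~ w) t}.
Proof.
move=> mX mG.
have mR t : rvec (fun w =>
    \sum_(i : {ffun 'I_N -> bool} | i != [ffun => false])
       (-1) ^+ (1 + \sum_l (i l : nat)) *:
          (expmx (- tTheta (idx_of_bits i) Th) *m X (subi t i) w) + Delta G t w).
  apply: rvecD; last exact: rfield_Delta.
  by apply: rvec_sum => i; apply: rvecZ; apply: rvec_mulmx; exact: mX.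
split => h t.
  apply: filterS (iffLR (as_eqP P (mX t) (mR t)) (h t)) => w.
  exact: (iffLR (recursion_innov Th (X^~ w) t _)).
apply/(as_eqP P (mX t) (mR t)); apply: filterS (h t) => w.
exact: (iffRL (recursion_innov Th (X^~ w) t _)).
Qed.

Lemma Mtheta_Ltheta X t w :
  Mtheta Th (Ltheta Th X) t w = sprim (innov Th (X^~ w)) t.
Proof. by rewrite sprim_innov. Qed.

Lemma rfield_Mtheta_Ltheta X : rfield X -> rfield (Mtheta Th (Ltheta Th X)).
Proof.
move=> mX t; apply: rvecZ; apply: rvec_sum => k; apply: rvec_mulmx.
by apply: rfield_Delta => s; apply: rvec_mulmx; exact: mX.
Qed.

Lemma Delta_Mtheta_Ltheta X t w :
  Delta (Mtheta Th (Ltheta Th X)) t w = innov Th (X^~ w) t.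
Proof.
rewrite -(dlt_sprim (innov Th (X^~ w))); apply: eq_bigr => i _.
by rewrite Mtheta_Ltheta.
Qed.

Lemma Mtheta_Ltheta_in_GTheta0 X : rfield X -> stationary P X -> cond_i P Th X ->
  in_GTheta0 P Th (Mtheta Th (Ltheta Th X)).
Proof.
move=> mX sX cX; have mG := rfield_Mtheta_Ltheta mX.
split; last first.
  move=> t t0; apply/(as_eqP P (mG t) (rvec_cst 0)).
  by apply: aeW => w; rewrite Mtheta_Ltheta sprim_axis.
split=> //.
  have := stationary_lin_filter (P := P) (fun i : {ffun 'I_N -> bool} =>
    (-1) ^+ (\sum_l (i l : nat)) *: expmx (- tTheta (idx_of_bits i) Th))
    (fun i => idx_of_bits i) mX sX.
  rewrite (_ : (fun t w => lin_filter _ _ _ _) = Delta (Mtheta Th (Ltheta Th X))) //.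
  apply/funext => t; apply/funext => w.
  by rewrite Delta_Mtheta_Ltheta innov_filter.
move=> t.
have GX s : {ae P, forall w, Delta (Mtheta Th (Ltheta Th X)) s w = innov Th (X^~ w) s}.
  by apply: aeW => w; exact: Delta_Mtheta_Ltheta.
have [L [cL _ _]] := iter_cvg_corner Th_comm mX cX
  (fun M => rvec_Minv_psum Th t M mG) (Minv_psum_ae Th_comm t GX).
by exists L.
Qed.

(** Yields both the formula for [G] and its uniqueness: on a single almost sure event all increments
    are prescribed and [G] vanishes on all coordinate hyperplanes, so [sprim_dlt] recovers the whole
    path. *)
Lemma eq_Mtheta_Ltheta X G : rfield X -> in_GTheta0 P Th G -> recursion P Th X G ->
  forall t, {ae P, forall w, G t w = Mtheta Th (Ltheta Th X) t w}.
Proof.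
move=> mX [[mG _ _] G0] /(recursion_ae mX mG) GX t.
have G0ae s : {ae P, forall w, (exists l, s l = 0) -> G s w = 0}.
  have [s0|ns0] := pselect (exists l, s l = 0); last by apply: aeW => w /ns0.
  have /as_eqP h := G0 s s0.
  by apply: filterS (h (mG s) (rvec_cst 0)) => w ->.
apply: filterS2 (ae_forall_idx GX) (ae_forall_idx G0ae) => w hGX hG0.
rewrite Mtheta_Ltheta -[LHS](@sprim_dlt _ _ _ (G^~ w))//.
by congr sprim; apply/funext => s; rewrite -hGX.
Qed.

End MainProof.

Theorem mainTheorem12 (R : realType) (d : measure_display) (T : measurableType d)
  (P : probability T R) (N n : nat) (Th : 'I_N -> 'M[R]_n)
  (Th_sym : forall j, (Th j)^T = Th j)
  (Th_pd : forall j (v : 'cV[R]_n), v != 0 -> 0 < (v^T *m Th j *m v) 0 0)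
  (Th_comm : forall i j, Th i *m Th j = Th j *m Th i)
  (X : idx N -> T -> 'cV[R]_n) (X_rv : rfield X) :
  (stationary P X <->
     (cond_i P Th X /\
      exists G, in_GTheta0 P Th G /\ recursion P Th X G))
  /\
  (stationary P X ->
     forall G, in_GTheta0 P Th G -> recursion P Th X G ->
       (* uniqueness of G *)
       (forall G', in_GTheta0 P Th G' -> recursion P Th X G' ->
          forall t, as_eq P (G t) (G' t))
       (* X = (L^-1_Theta o M^-1_Theta)(G) *)
       /\ (forall t, exists L, iter_cvg_prob P (Minv_psum Th G t) L /\
             as_eq P (X t) (fun w => expmx (- tTheta t Th) *m L w))
       (* G = (M_Theta o L_Theta)(X) *)
       /\ (forall t, as_eq P (G t) (Mtheta Th (Ltheta Th X) t))).
Proof.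
have part1 : stationary P X -> cond_i P Th X by exact: stationary_cond_i.
split; [split|].
- move=> sX; have cX := part1 sX; split=> //.
  exists (Mtheta Th (Ltheta Th X)); split; first exact: Mtheta_Ltheta_in_GTheta0.
  apply/(recursion_ae P Th X_rv (rfield_Mtheta_Ltheta Th X_rv)) => t.
  by apply: aeW => w; exact: Delta_Mtheta_Ltheta.
- move=> [cX [G [[[mG sG _] _] rG]]].
  apply: (stationary_of_recursion Th_comm X_rv cX mG sG).
  exact/(recursion_ae P Th X_rv mG).
move=> sX G hG rG; have cX := part1 sX; have [[mG _ _] _] := hG.
have mM := rfield_Mtheta_Ltheta Th X_rv.
split; [|split].
- move=> G' hG' rG' t; have [[mG' _ _] _] := hG'.
  apply/as_eqP; [exact: mG|exact: mG'|].
  apply: filterS2 (eq_Mtheta_Ltheta Th_comm X_rv hG rG t)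
    (eq_Mtheta_Ltheta Th_comm X_rv hG' rG' t) => w -> //.
- move=> t.
  have [L [cL mL eL]] := iter_cvg_corner Th_comm X_rv cX
    (fun M => rvec_Minv_psum Th t M mG)
    (Minv_psum_ae Th_comm t (iffLR (recursion_ae P Th X_rv mG) rG)).
  exists L; split=> //; apply/as_eqP; [exact: X_rv|exact: rvec_mulmx|].
  apply: filterS eL => w ->.
  by rewrite expThetaN mulmxA (expThetaNK Th_comm) mul1mx.
- move=> t; apply/as_eqP; [exact: mG|exact: mM|].
  exact: eq_Mtheta_Ltheta.
Qed.
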